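(* A (non-empty) Richardson variety in $G(k,n)$ is smooth if and only if it is a Segre product of Grassmannians.
   Context: Work over $\mathbb{C}$. $G(k,n)$ is the Grassmannian of $k$-dimensional subspaces of an $n$-dimensional vector space $V$ with ordered basis $e_1,\dots,e_n$; $F_i=\langle e_1,\dots,e_i\rangle$, $G_i=\langle e_n,\dots,e_{n-i+1}\rangle$. For $u=(u_1<\dots<u_k)$ with $u_i\in\{1,\dots,n\}$, the Schubert varieties are $X_u=\{\Lambda\mid\dim(\Lambda\cap F_{u_i})\ge i \ \forall i\}$ and $X^v=\{\Lambda\mid\dim(\Lambda\cap G_{v_i})\ge i\ \forall i\}$. A Richardson variety is $R(u,v)=X_u\cap X^v$. Segre product of Grassmannians: given integers $k_i\le n_i$ with $\sum_i k_i=k$ and $\sum_i n_i\le n$, and subspaces $V_1,\dots,V_r\subset V$ of dimensions $n_1,\dots,n_r$ whose sum is direct, the Segre product $G(k_1,n_1)\times\dots\times G(k_r,n_r)$ in $G(k,n)$ is the image of $\prod_i G(k_i,V_i)$ under the direct sum map $(W_1,\dots,W_r)\mapsto W_1\oplus\dots\oplus W_r$. *)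

(* Defs.v *)
From mathcomp Require Import all_boot all_order all_algebra.
From mathcomp Require Import mpoly.
From mathcomp Require Import classical_sets.
Import GRing.Theory.

Set Implicit Arguments.
Unset Strict Implicit.
Unset Printing Implicit Defensive.

Local Open Scope ring_scope.
Local Open Scope classical_set_scope.

Section AffineGeometry.
Variables (K : fieldType) (N : nat).
Implicit Types (S : set {mpoly K[N]}) (Z : set 'rV[K]_N) (x v : 'rV[K]_N).

Definition zero_locus S : set 'rV[K]_N :=
  [set x | forall p, S p -> p.@[x 0] = 0].

Definition vanishing_ideal Z : set {mpoly K[N]} :=
  [set p | forall x, Z x -> p.@[x 0] = 0].

Definition zariski_closed Z := exists S, Z = zero_locus S.

Definition irreducible_closed Z :=
  [/\ zariski_closed Z, Z !=set0 &
      forall A B, zariski_closed A -> zariski_closed B ->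
        Z `<=` A `|` B -> Z `<=` A \/ Z `<=` B].

(* A chain c 0 < ... < c d of irreducible closed subsets of Z through x; the   *)
(* values of c beyond d are irrelevant.                                        *)
Definition irreducible_chain_at Z x (d : nat) (c : nat -> set 'rV[K]_N) :=
  (forall i, (i <= d)%N -> [/\ irreducible_closed (c i), c i `<=` Z & c i x])
  /\ (forall i, (i < d)%N -> c i `<` c i.+1).

(* For Z closed and x in Z, the Krull dimension of the local ring of Z at x:   *)
(* its primes correspond to the irreducible closed subsets of Z through x.     *)
Definition local_dim Z x (d : nat) :=
  (exists c, irreducible_chain_at Z x d c) /\
  (forall d' c, irreducible_chain_at Z x d' c -> (d' <= d)%N).

Definition tangent_space Z x : set 'rV[K]_N :=
  [set v | forall p, vanishing_ideal Z p ->
             \sum_(i < N) (p^`M(i)).@[x 0] * v 0 i = 0].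

Definition tangent_dim Z x (d : nat) :=
  exists T : {vspace 'rV[K]_N},
    [set` T] = tangent_space Z x /\ (\dim T = d).

(* Z carries its reduced structure; this is regularity of its local ring at x. *)
Definition smooth_at Z x := exists d, local_dim Z x d /\ tangent_dim Z x d.

End AffineGeometry.

Section Grassmannian.
Variables (K : fieldType) (V : vectType K) (n : nat) (e : n.-tuple V).
Implicit Types (L : {vspace V}) (X : set {vspace V}).

Definition grassmannian (k : nat) : set {vspace V} := [set L | \dim L = k].

Definition row_span (k : nat) (M : 'M[K]_(k, n)) : {vspace V} :=
  <<[seq (\sum_(j < n) M i j *: e`_j)%R | i : 'I_k]>>%VS.

(* For an injective f, the subspaces of dimension k whose Pluecker coordinate  *)
(* at the columns f 0, ..., f (k - 1) is nonzero are the row spans of unique   *)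
(* matrices M with identity submatrix at these columns.  So such M form an     *)
(* affine space of dimension k * (n - k), here inside K^(k * n), and these     *)
(* spaces are the standard affine charts covering the Grassmannian.            *)
Definition chart_part (k : nat) (f : 'I_k -> 'I_n) X : set 'rV[K]_(k * n) :=
  [set mxvec M | M in [set M : 'M[K]_(k, n) |
                         colsub f M = 1%:M /\ X (row_span M)]].

(* Smoothness of a closed subvariety X of the Grassmannian. *)
Definition smooth_subvariety (k : nat) X :=
  forall f : 'I_k -> 'I_n, injective f ->
  forall x, chart_part f X x -> smooth_at (chart_part f X) x.

Definition flagF (i : nat) : {vspace V} := <<take i e>>%VS.
Definition flagG (i : nat) : {vspace V} := <<take i (rev e)>>%VS.

(* The index i : 'I_k starts at 0, whereas the values u i start at 1. *)
Definition schubert_index (k : nat) (u : 'I_k -> nat) :=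
  (forall i, (1 <= u i <= n)%N) /\
  (forall i j : 'I_k, (i < j)%N -> (u i < u j)%N).

Definition schubertF (k : nat) (u : 'I_k -> nat) : set {vspace V} :=
  [set L | grassmannian k L /\
           forall i : 'I_k, (i.+1 <= \dim (L :&: flagF (u i)))%N].

Definition schubertG (k : nat) (v : 'I_k -> nat) : set {vspace V} :=
  [set L | grassmannian k L /\
           forall i : 'I_k, (i.+1 <= \dim (L :&: flagG (v i)))%N].

Definition richardson (k : nat) (u v : 'I_k -> nat) : set {vspace V} :=
  schubertF u `&` schubertG v.

End Grassmannian.

Section SegreProduct.
Variables (K : fieldType) (V : vectType K).

Definition segre_product (r : nat) (ks : 'I_r -> nat)
    (Vs : 'I_r -> {vspace V}) : set {vspace V} :=
  [set (\sum_(i < r) W i)%VS | W in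
     [set W : 'I_r -> {vspace V} |
        forall i, (W i <= Vs i)%VS /\ grassmannian (ks i) (W i)]].

Definition is_segre_product (n k : nat) (X : set {vspace V}) :=
  exists (r : nat) (ks ns : 'I_r -> nat) (Vs : 'I_r -> {vspace V}),
    [/\ forall i, (ks i <= ns i)%N,
        (\sum_(i < r) ks i = k)%N & (\sum_(i < r) ns i <= n)%N] /\
    [/\ forall i, \dim (Vs i) = ns i,
        directv (\sum_(i < r) Vs i)%VS &
        X = segre_product ks Vs].

End SegreProduct.

(* Main.v *)
From HB Require Import structures.
Require Import Defs.
From mathcomp Require Import all_boot all_order all_algebra.
From mathcomp Require Import complex mpoly.
From mathcomp Require Import boolp classical_sets reals.
From mathcomp Require Import zify ring.

(** Count positions from 0 and put w s = n - v (rev_ord s). A space in the Richardson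
    variety has dimension at least s + 1 in the first u s basis vectors and at least
    k - s in those from position w s on, so its s-th row ranges over the interval of
    positions from w s up to u s. Call two consecutive rows linked when their intervals
    overlap. The variety is a Segre product exactly when linked rows have intervals
    that are translates of each other by one.

    If they are, every member is the direct sum of its intersections with the spans of
    the runs of linked intervals, and these intersections are arbitrary subspaces
    of the right dimensions (richardson_is_segre_product).

    If they are not, say u jumps by more than one between linked rows. Every member has
    a basis adapted to both flags (two_weight_basis), so the variety is covered by
    finitely many rational images of affine spaces of dimension at most the sum of the
    u s - w s - 1, and its local dimensions are at most this sum
    (richardson_chain_bound). At the coordinate subspace of w, however, the lines
    obtained by adding a multiple of a basis vector to one of the spanning basis vectors
    give more tangent directions than that (many_lines). A jump of v becomes a jump of u
    when the basis is reversed.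

    A Segre product consists of the subspaces graded by the projections to the factors.
    At a graded space the complements that are graded as well provide a chart in which
    to be graded is a linear condition, and the change of charts is rational in both
    directions. Hence the local dimension and the tangent space are those of a linear
    space (graded_chart_smooth_at).

    The dimension is defined by chains of irreducible closed sets. Lengths of chains are
    bounded by counting: a chain of length m produces t ^ m linearly independent
    functions of degree O(t) on its top member (chain_independent), whereas on the image
    of a rational map from affine d-space there can only be O(t ^ d) of them
    (dependent_of_msize). *)

Set Implicit Arguments.
Unset Strict Implicit.
Unset Printing Implicit Defensive.

Import Order.TTheory GRing.Theory Num.Theory passmx.
Local Open Scope ring_scope.
Local Open Scope classical_set_scope.

(** * Polynomial functions *)

Section PolynomialFunctions.
Variable K : numFieldType.

Definition polyfun N (f : 'rV[K]_N -> K) :=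
  exists p : {mpoly K[N]}, forall x, f x = p.@[x 0].

Section Closure.
Variable N : nat.
Implicit Types f g : 'rV[K]_N -> K.

Lemma polyfun_meval (p : {mpoly K[N]}) : polyfun (fun x => p.@[x 0]).
Proof. by exists p. Qed.

Lemma polyfun_ext f g : f =1 g -> polyfun f -> polyfun g.
Proof. by move=> fg [p pE]; exists p => x; rewrite -fg. Qed.

Lemma polyfun_cst c : polyfun (fun _ : 'rV[K]_N => c).
Proof. by exists c%:MP => x; rewrite mevalC. Qed.

Lemma polyfun_coord i : polyfun (fun x : 'rV[K]_N => x 0 i).
Proof. by exists 'X_i => x; rewrite mevalXU. Qed.

Lemma polyfunD f g : polyfun f -> polyfun g -> polyfun (fun x => f x + g x).
Proof. by move=> [p pE] [q qE]; exists (p + q) => x; rewrite mevalD pE qE. Qed.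

Lemma polyfunM f g : polyfun f -> polyfun g -> polyfun (fun x => f x * g x).
Proof. by move=> [p pE] [q qE]; exists (p * q) => x; rewrite mevalM pE qE. Qed.

Lemma polyfunB f g : polyfun f -> polyfun g -> polyfun (fun x => f x - g x).
Proof. by move=> [p pE] [q qE]; exists (p - q) => x; rewrite mevalB pE qE. Qed.

Lemma polyfun_sum (I : Type) (r : seq I) (P : pred I) (F : I -> 'rV[K]_N -> K) :
  (forall i, polyfun (F i)) -> polyfun (fun x => \sum_(i <- r | P i) F i x).
Proof.
move=> pF; elim: r => [|i r IH].
  by apply: polyfun_ext (polyfun_cst 0) => x; rewrite big_nil.
case Pi: (P i); last by apply: polyfun_ext IH => x; rewrite big_cons Pi.
by apply: polyfun_ext (polyfunD (pF i) IH) => x; rewrite big_cons Pi.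
Qed.

Lemma polyfun_prod (I : Type) (r : seq I) (P : pred I) (F : I -> 'rV[K]_N -> K) :
  (forall i, polyfun (F i)) -> polyfun (fun x => \prod_(i <- r | P i) F i x).
Proof.
move=> pF; elim: r => [|i r IH].
  by apply: polyfun_ext (polyfun_cst 1) => x; rewrite big_nil.
case Pi: (P i); last by apply: polyfun_ext IH => x; rewrite big_cons Pi.
by apply: polyfun_ext (polyfunM (pF i) IH) => x; rewrite big_cons Pi.
Qed.

Definition polymx m n (F : 'rV[K]_N -> 'M[K]_(m, n)) :=
  forall i j, polyfun (fun x => F x i j).

Lemma polymx_cst m n (A : 'M[K]_(m, n)) : polymx (fun _ : 'rV_N => A).
Proof. by move=> i j; apply: polyfun_cst. Qed.

Lemma polymxD m n (F G : 'rV[K]_N -> 'M[K]_(m, n)) :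
  polymx F -> polymx G -> polymx (fun x => F x + G x).
Proof.
by move=> pF pG i j; apply: polyfun_ext (polyfunD (pF i j) (pG i j)) => x;
  rewrite mxE.
Qed.

Lemma polymxB m n (F G : 'rV[K]_N -> 'M[K]_(m, n)) :
  polymx F -> polymx G -> polymx (fun x => F x - G x).
Proof.
by move=> pF pG i j; apply: polyfun_ext (polyfunB (pF i j) (pG i j)) => x;
  rewrite !mxE.
Qed.

Lemma polymxM m n p (F : 'rV[K]_N -> 'M[K]_(m, n)) (G : 'rV_N -> 'M_(n, p)) :
  polymx F -> polymx G -> polymx (fun x => F x *m G x).
Proof.
move=> pF pG i j.
have := polyfun_sum (index_enum 'I_n) xpredT (fun l => polyfunM (pF i l) (pG l j)).
by apply: polyfun_ext => x; rewrite mxE.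
Qed.

Lemma polymxZ m n f (F : 'rV[K]_N -> 'M[K]_(m, n)) :
  polyfun f -> polymx F -> polymx (fun x => f x *: F x).
Proof.
by move=> pf pF i j; apply: polyfun_ext (polyfunM pf (pF i j)) => x; rewrite mxE.
Qed.

Lemma polymx_colsub k m n (g : 'I_m -> 'I_n) (F : 'rV[K]_N -> 'M[K]_(k, n)) :
  polymx F -> polymx (fun x => colsub g (F x)).
Proof.
by move=> pF i j; apply: polyfun_ext (pF i (g j)) => x; rewrite mxE.
Qed.

Lemma polyfun_det n (F : 'rV[K]_N -> 'M[K]_n) :
  polymx F -> polyfun (fun x => \det (F x)).
Proof.
move=> pF; apply: polyfun_sum => s; apply: polyfunM; first exact: polyfun_cst.
by apply: polyfun_prod => i; apply: pF.
Qed.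

Lemma polymx_adj n (F : 'rV[K]_N -> 'M[K]_n) :
  polymx F -> polymx (fun x => \adj (F x)).
Proof.
move=> pF i j.
suff h : polyfun (fun x => cofactor (F x) j i).
  by apply: polyfun_ext h => x; rewrite mxE.
apply: polyfunM; first exact: polyfun_cst.
apply: polyfun_det => a b; apply: polyfun_ext (pF (lift j a) (lift i b)) => x.
by rewrite !mxE.
Qed.

Lemma polymx_mxvec m n (F : 'rV[K]_N -> 'M[K]_(m, n)) :
  polymx F -> polymx (fun x => mxvec (F x)).
Proof.
move=> pF i j; rewrite ord1; case/mxvec_indexP: j => a b.
by apply: polyfun_ext (pF a b) => x; rewrite mxvecE.
Qed.

End Closure.

Lemma polymx_vec_mx m n : polymx (fun x : 'rV[K]_(m * n) => vec_mx x).
Proof.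
move=> i j; apply: polyfun_ext (polyfun_coord (mxvec_index i j)) => x.
by rewrite mxE.
Qed.

(** * Restriction to lines *)

Lemma poly_eq0_of_horner (P : {poly K}) : (forall t, P.[t] = 0) -> P = 0.
Proof.
move=> P0; apply/eqP/negPn/negP => nzP.
pose s : seq K := [seq i%:R | i <- iota 0 (size P)].
have us : uniq s.
  by rewrite map_inj_uniq ?iota_uniq // => i j /eqP; rewrite eqr_nat => /eqP.
have sr : all (root P) s by apply/allP => x _; rewrite /root P0.
by have := max_poly_roots nzP sr us; rewrite size_map size_iota ltnn.
Qed.

Lemma poly_eq0_of_horner_neq0 (P Q : {poly K}) :
  Q != 0 -> (forall t, Q.[t] != 0 -> P.[t] = 0) -> P = 0.
Proof.
move=> nzQ PQ; have : P * Q = 0.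
  apply: poly_eq0_of_horner => t; rewrite hornerM.
  by case: (eqVneq Q.[t] 0) => [->|/PQ ->]; rewrite ?mulr0 ?mul0r.
by move/eqP; rewrite mulf_eq0 (negPf nzQ) orbF => /eqP.
Qed.

Lemma mpoly_ring_ind N (Q : {mpoly K[N]} -> Prop) :
  (forall c, Q c%:MP) -> (forall i, Q 'X_i) ->
  (forall p q, Q p -> Q q -> Q (p + q)) ->
  (forall p q, Q p -> Q q -> Q (p * q)) -> forall p, Q p.
Proof.
move=> QC QX QD QM; elim/mpolyind => [|c m p _ _ Qp]; first exact: QC 0.
apply: (QD) Qp; rewrite -mul_mpolyC; apply: (QM); first exact: QC.
rewrite mpolyXE_id; apply: (big_ind Q) => [||i _]; [exact: QC 1 | exact: QM | ].
by elim: (m i) => [|e IH]; [apply: QC 1 | rewrite exprS; apply: (QM)].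
Qed.

(** The coefficient of degree one of the restriction of p to a line is the
    directional derivative of p; this is the only calculus that tangent spaces
    require. *)
Lemma restrict_line N (p : {mpoly K[N]}) (x v : 'rV[K]_N) :
  exists P : {poly K}, (forall t, P.[t] = p.@[(x + t *: v) 0]) /\
    P`_1 = \sum_(i < N) (p^`M(i)).@[x 0] * v 0 i.
Proof.
elim/mpoly_ring_ind: p => [c|i|p q [P [PE P1]] [Q [QE Q1]]|p q [P [PE P1]] [Q [QE Q1]]].
- exists c%:P; split=> [t|]; first by rewrite hornerC mevalC.
  rewrite coefC big1 // => i _; by rewrite mderivC meval0 mul0r.
- exists ((x 0 i)%:P + v 0 i *: 'X); split=> [t|].
    by rewrite !hornerE mevalXU !mxE mulrC.
  rewrite coefD coefC coefZ coefX /= add0r mulr1 (bigD1 i) //= big1 => [|j ji].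
    have -> : ('X_i : {mpoly K[N]})^`M(i) = 1.
      rewrite mderivX mnm1E eqxx scale1r -mpolyX0; congr 'X_[_].
      by apply/mnmP=> j; rewrite mnmBE subnn mnm0E.
    by rewrite meval1 mul1r addr0.
  by rewrite mderivX mnm1E eq_sym (negPf ji) scale0r meval0 mul0r.
- exists (P + Q); split=> [t|]; first by rewrite hornerD PE QE mevalD.
  rewrite coefD P1 Q1 -big_split /=; apply: eq_bigr => i _.
  by rewrite mderivD mevalD mulrDl.
- exists (P * Q); split=> [t|]; first by rewrite hornerM PE QE mevalM.
  rewrite coefM !big_ord_recl big_ord0 /= addr0.
  have h0 (R : {poly K}) (r : {mpoly K[N]}) :
      (forall t, R.[t] = r.@[(x + t *: v) 0]) -> R`_0 = r.@[x 0].
    by move=> RE; rewrite -horner_coef0 RE scale0r addr0.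
  rewrite (h0 _ _ PE) (h0 _ _ QE) P1 Q1 mulr_sumr mulr_suml -big_split /=.
  apply: eq_bigr => i _; rewrite mderivM mevalD !mevalM mulrDl addrC.
  by rewrite mulrAC mulrA.
Qed.

End PolynomialFunctions.

(** * Closures, irreducible sets and the dimension bound *)

Section Zariski.
Variables (K : numFieldType) (N : nat).
Implicit Types (Z C A : set 'rV[K]_N) (p q : {mpoly K[N]}).

Definition zariski_closure Z : set 'rV[K]_N := zero_locus (vanishing_ideal Z).

Lemma zariski_closure_closed Z : zariski_closed (zariski_closure Z).
Proof. by exists (vanishing_ideal Z). Qed.

Lemma subset_zariski_closure Z : Z `<=` zariski_closure Z.
Proof. by move=> x Zx p; apply. Qed.

Lemma zariski_closure_sub Z A : zariski_closed A -> Z `<=` A ->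
  zariski_closure Z `<=` A.
Proof. by move=> [S ->] ZS x Zx p Sp; apply: Zx => z /ZS; apply. Qed.

Lemma zero_locus_polyfun (I : Type) (f : I -> 'rV[K]_N -> K) :
  (forall i, polyfun (f i)) -> zariski_closed [set x | forall i, f i x = 0].
Proof.
move=> /boolp.choice[p pE]; exists (range p).
apply/seteqP; split=> x /= fx.
  by move=> _ [i _ <-]; rewrite -pE.
by move=> i; rewrite pE; apply: fx; exists i.
Qed.

Lemma irreducible_prime C p q : irreducible_closed C ->
  (forall x, C x -> p.@[x 0] * q.@[x 0] = 0) ->
  (forall x, C x -> p.@[x 0] = 0) \/ (forall x, C x -> q.@[x 0] = 0).
Proof.
move=> [_ _ irrC] pq0.
have [||x Cx|CA|CA] := irrC (zero_locus [set p]) (zero_locus [set q]).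
- by exists [set p].
- by exists [set q].
- by have /eqP := pq0 x Cx; rewrite mulf_eq0 => /orP[] /eqP h; [left|right] => _ ->.
- by left=> x /CA; apply.
- by right=> x /CA; apply.
Qed.

(** A finite union of closed sets is closed: products of equations define it. *)
Lemma irreducible_sub_bigcup C (J : eqType) (s : seq J) (A : J -> set 'rV[K]_N) :
  irreducible_closed C -> (forall j, zariski_closed (A j)) ->
  C `<=` [set x | exists2 j, j \in s & A j x] ->
  exists2 j, j \in s & C `<=` A j.
Proof.
move=> irrC clA; elim: s => [|j s IH] Cs.
  by have [_ [x Cx] _] := irrC; have [] := Cs x Cx.
have [_ _ /(_ (A j) [set x | exists2 i, i \in s & A i x])] := irrC.
case; first exact: clA.
- clear IH Cs; elim: s => [|i s [S IH]].
    exists [set 1]; apply/seteqP; split=> x /=; first by case.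
    by move/(_ _ erefl)/eqP; rewrite meval1 oner_eq0.
  have [T AT] := clA i.
  exists [set r | exists2 t, T t & exists2 u, S u & r = t * u].
  apply/seteqP; split=> x.
    move=> [l]; rewrite inE => /orP[/eqP-> | ls] Ax r [t Tt [u Su ->]]; rewrite mevalM.
      by move: Ax; rewrite AT => /(_ t Tt) ->; rewrite mul0r.
    have : zero_locus S x by rewrite -IH; exists l.
    by move=> /(_ u Su) ->; rewrite mulr0.
  move=> h; have [Aix|nAix] := pselect (A i x); first by exists i; rewrite ?mem_head.
  suff : zero_locus S x.
    by rewrite -IH => -[l ls Al]; exists l; rewrite // in_cons ls orbT.
  move=> u Su; move: nAix; rewrite AT => /existsNP[t /not_implyP[Tt /eqP tx]].
  have : (t * u).@[x 0] = 0 by apply: h; exists t => //; exists u.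
  by rewrite mevalM => /eqP; rewrite mulf_eq0 (negPf tx) => /eqP.
- move=> x Cx; have [l] := Cs x Cx; rewrite inE => /orP[/eqP-> | ls] Ax; first by left.
  by right; exists l.
- by move=> CA; exists j; rewrite ?mem_head.
- by move=> /IH[i si CA]; exists i; rewrite // in_cons si orbT.
Qed.

Definition independent_on C (I : finType) (g : I -> {mpoly K[N]}) :=
  forall l : I -> K, (forall x, C x -> \sum_i l i * (g i).@[x 0] = 0) ->
  forall i, l i = 0.

(** Multiplying an independent family on a smaller irreducible set by the powers
    of an equation p of that set keeps independence on the larger one: a relation
    restricts to its part free of p, and what remains can be divided by p. *)
Lemma independent_on_powers C C' (I : finType) (g : I -> {mpoly K[N]}) p t :
  irreducible_closed C' -> C `<=` C' -> (forall x, C x -> p.@[x 0] = 0) ->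
  ~ (forall x, C' x -> p.@[x 0] = 0) -> independent_on C g ->
  independent_on C' (fun ij : I * 'I_t => p ^+ ij.2 * g ij.1).
Proof.
move=> irrC' CC' pC npC' indg.
suff h (l : I -> 'I_t -> K) :
    (forall x, C' x -> \sum_(j < t) \sum_i l i j * (p.@[x 0] ^+ j * (g i).@[x 0]) = 0) ->
    forall i j, l i j = 0.
  move=> l l0 [i j]; apply: (h (fun i j => l (i, j))) => x C'x.
  rewrite exchange_big pair_bigA /= -[RHS](l0 x C'x).
  by apply: eq_bigr => -[a b] _; rewrite mevalM rmorphXn.
elim: t l => [|t IH] l l0 i j; first by case: j.
have {}l0 x : C' x -> \sum_i l i ord0 * (g i).@[x 0] +
    p.@[x 0] * \sum_(j < t) \sum_i l i (lift ord0 j) * (p.@[x 0] ^+ j * (g i).@[x 0]) = 0.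
  move=> /l0; rewrite big_ord_recl => l0x; rewrite -[RHS]l0x; congr (_ + _).
    by apply: eq_bigr => a _; rewrite expr0 mul1r.
  rewrite mulr_sumr; apply: eq_bigr => b _; rewrite mulr_sumr.
  by apply: eq_bigr => a _; rewrite exprS mulrCA !mulrA.
have li0 a : l a ord0 = 0.
  apply: (indg (fun a => l a ord0)) => x Cx.
  by have := l0 x (CC' _ Cx); rewrite pC // mul0r addr0.
pose r := \sum_(j < t) \sum_i l i (lift ord0 j) *: (p ^+ j * g i).
have rE (x : 'rV[K]_N) : r.@[x 0] =
    \sum_(j < t) \sum_i l i (lift ord0 j) * (p.@[x 0] ^+ j * (g i).@[x 0]).
  rewrite raddf_sum; apply: eq_bigr => b _; rewrite raddf_sum.
  by apply: eq_bigr => a _; rewrite /= mevalZ mevalM rmorphXn.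
have [x /l0 | // | r0] := irreducible_prime (p := p) (q := r) irrC'.
  by rewrite rE big1 ?add0r // => a _; rewrite li0 mul0r.
have {}r0 := IH (fun i j => l i (lift ord0 j)) (fun x C'x => etrans (esym (rE x)) (r0 x C'x)).
by case: (unliftP ord0 j) => [j' ->|->]; rewrite ?li0 ?r0.
Qed.

(** Along a chain of length m the polynomial functions of degree O(t) on the top
    member contain at least t ^ m independent ones: the lower bound on the Hilbert
    function that replaces transcendence degrees. *)
Lemma chain_independent (m : nat) (c : nat -> set 'rV[K]_N) :
  (forall i, (i <= m)%N -> irreducible_closed (c i)) ->
  (forall i, (i < m)%N -> c i `<` c i.+1) ->
  exists A : nat, forall t, exists (I : finType) (g : I -> {mpoly K[N]}),
    [/\ #|I| = (t ^ m)%N, independent_on (c m) g &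
        forall i, (msize (g i) <= (A * t).+1)%N].
Proof.
elim: m => [|m IH] irrc cc.
  exists 0%N => t; exists 'I_1, (fun=> 1); split=> [||i].
  - by rewrite card_ord expn0.
  - move=> l l0 i; have [_ [x cx] _] := irrc 0%N isT.
    by have := l0 x cx; rewrite big_ord1 meval1 mulr1 (ord1 i).
  - by rewrite msize1.
have [i /leqW|i /leqW|A hA] := IH; [exact: irrc | exact: cc |].
have [cm ncm] := cc m (ltnSn m).
have [p pC npC] : exists2 p, (forall x, c m x -> p.@[x 0] = 0) &
    ~ forall x, c m.+1 x -> p.@[x 0] = 0.
  have [[S cS] _ _] := irrc m (leqnSn m).
  apply: contrapT => /forall2NP h; apply: ncm => x cx; rewrite cS => p Sp.
  by case: (h p) => [[] y | /contrapT ->] //; rewrite cS; apply.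
exists (A + msize p)%N => t; have [I [g [cardI indg szg]]] := hA t.
exists (I * 'I_t)%type, (fun ij : I * 'I_t => p ^+ ij.2 * g ij.1); split.
- by rewrite card_prod cardI card_ord expnSr.
- exact: (independent_on_powers (irrc _ (leqnn _)) cm pC npC indg).
have degX j : (msize (p ^+ j) <= (msize p * j).+1)%N.
  elim: j => [|j IHj]; first by rewrite expr0 msize1.
  have [p0|nzp] := eqVneq p 0; first by rewrite p0 exprS mul0r msize0.
  rewrite exprS; have [->|nz] := eqVneq (p ^+ j) 0; first by rewrite mulr0 msize0.
  by rewrite msizeM // mulnS; move: (msize p) (msize _) IHj => a b; lia.
move=> [i j] /=.
have [->|nzp] := eqVneq (p ^+ j) 0; first by rewrite mul0r msize0.
have [->|nzg] := eqVneq (g i) 0; first by rewrite mulr0 msize0.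
rewrite msizeM //; have := degX j; have := szg i; have := ltn_ord j.
move: (msize (p ^+ j)) (msize (g i)) (msize p) => a b e; nia.
Qed.

End Zariski.

Section RationalImages.
Variable K : numFieldType.

Definition rational_image d N (a : 'rV[K]_d -> 'rV[K]_N) (q : 'rV[K]_d -> K) :=
  [set (q y)^-1 *: a y | y in [set y | q y != 0]].

(** Substituting a / q into a polynomial of degree at most D and multiplying by
    q ^ D gives a polynomial whose degree grows linearly in D. *)
Section Homogenization.
Variables (d N : nat) (a : 'I_N -> {mpoly K[d]}) (q : {mpoly K[d]}) (D : nat).

Definition homogenize (p : {mpoly K[N]}) : {mpoly K[d]} :=
  \sum_(m <- msupp p) p@_m *: (\prod_i a i ^+ m i * q ^+ (D - mdeg m)).

Lemma meval_homogenize p (y : 'I_d -> K) : (msize p <= D.+1)%N -> q.@[y] != 0 ->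
  (homogenize p).@[y] = q.@[y] ^+ D * p.@[fun i => q.@[y]^-1 * (a i).@[y]].
Proof.
move=> szp nzq; rewrite (mevalE _ p) mulr_sumr raddf_sum /=.
apply: eq_big_seq => m mp; rewrite mevalZ mevalM rmorphXn rmorph_prod /=.
have mD : (mdeg m <= D)%N.
  by rewrite -ltnS; apply: leq_trans szp; apply: msize_mdeg_lt.
rewrite [RHS]mulrCA; congr (_ * _).
transitivity ((\prod_i (a i).@[y] ^+ m i) * q.@[y] ^+ (D - mdeg m)).
  by congr (_ * _); apply: eq_bigr => i _; rewrite rmorphXn.
rewrite -[in RHS](subnK mD) exprD -mulrA mulrC; congr (_ * _).
rewrite [mdeg m]mdegE expr_sum -big_split /=; apply: eq_bigr => i _.
by rewrite -exprMn mulVKf.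
Qed.

Lemma msize_homogenize e p : (forall i, (msize (a i) <= e.+1)%N) ->
  (msize q <= e.+1)%N -> (msize p <= D.+1)%N ->
  (msize (homogenize p) <= (D * e).+1)%N.
Proof.
move=> sza szq szp.
have szM r s b1 b2 : (msize r <= b1.+1)%N -> (msize s <= b2.+1)%N ->
    (msize (r * s : {mpoly K[d]}) <= (b1 + b2).+1)%N.
  have [->|nzr] := eqVneq r 0; first by rewrite mul0r msize0.
  have [->|nzs] := eqVneq s 0; first by rewrite mulr0 msize0.
  by rewrite msizeM //; move: (msize r) (msize s) => x y; lia.
have szX r j : (msize r <= e.+1)%N -> (msize (r ^+ j : {mpoly K[d]}) <= (j * e).+1)%N.
  move=> szr; elim: j => [|j IHj]; first by rewrite expr0 msize1.
  by rewrite exprS mulSn; apply: (szM).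
rewrite /homogenize big_seq.
apply: (big_ind (fun r : {mpoly K[d]} => msize r <= (D * e).+1)%N).
- by rewrite msize0.
- move=> r s szr szs; apply: leq_trans (msizeD_le _ _) _.
  by rewrite geq_max szr szs.
move=> m mp; apply: leq_trans (msizeZ_le _ _) _.
have mD : (mdeg m <= D)%N.
  by rewrite -ltnS; apply: leq_trans szp; apply: msize_mdeg_lt.
rewrite -{2}(subnKC mD) mulnDl; apply: (szM); last exact: szX.
rewrite mdegE big_distrl /=.
elim/big_rec2: _ => [|i x r _ szr]; first by rewrite msize1.
by apply: szM => //; apply: szX.
Qed.

End Homogenization.

(** Polynomials of degree at most e in d variables lie in a space of dimension at most
    (e + 1) ^ d, that of the exponents bounded by e in each variable. *)
Lemma dependent_of_msize d (I : finType) (g : I -> {mpoly K[d]}) e :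
  (forall i, (msize (g i) <= e.+1)%N) -> (e.+1 ^ d < #|I|)%N ->
  exists2 l : I -> K, \sum_i l i *: g i = 0 & exists i, l i != 0.
Proof.
move=> szg cardI; pose J := {ffun 'I_d -> 'I_e.+1}.
pose A : 'M[K]_(#|I|, #|J|) :=
  \matrix_(i, j) (g (enum_val i))@_[multinom ((enum_val j : J) x : nat) | x < d].
have : kermx A != 0.
  rewrite kermx_eq0 /row_free; apply: contraTneq cardI => <-.
  rewrite -leqNgt; apply: leq_trans (rank_leq_col A) _.
  by rewrite card_ffun !card_ord.
case/rowV0Pn => v /sub_kermxP vA0 nzv.
exists (fun i => v 0 (enum_rank i)).
  apply/mpolyP => m; rewrite mcoeff0 raddf_sum /=.
  have [me|] := boolP [forall x, (m x < e.+1)%N].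
    pose j : J := [ffun x => inord (m x)].
    have mE : m = [multinom (j x : nat) | x < d].
      by apply/mnmP => x; rewrite mnmE ffunE inordK ?(forallP me).
    have /rowP/(_ (enum_rank j)) := vA0; rewrite !mxE => vAj; rewrite -[RHS]vAj.
    rewrite (reindex (@enum_val I predT)) /=; last first.
      by apply: onW_bij; apply: enum_val_bij.
    apply: eq_bigr => i _; rewrite mcoeffZ enum_valK mxE enum_rankK -mE.
    by [].
  case/forallPn => x; rewrite -leqNgt => xe; rewrite big1 // => i _.
  rewrite mcoeffZ; have [h|/memN_msupp_eq0 ->] := boolP (m \in msupp (g i)); last by rewrite mulr0.
  have := leq_trans (msize_mdeg_lt h) (szg i); rewrite ltnS mdegE.
  by rewrite (bigD1 x) //= => /(leq_trans (leq_addr _ _)); rewrite leqNgt xe.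
have /rV0Pn[j nzj] := nzv.
by exists (enum_val j); rewrite enum_valK.
Qed.

(** The t ^ m independent functions of degree O(t) provided by a chain pull back to
    independent polynomials of degree O(t) in d variables, of which there are only
    O(t ^ d). *)
Lemma chain_length_rational_image d N (a : 'rV[K]_d -> 'rV[K]_N) q m c :
  polymx a -> polyfun q ->
  (forall i, (i <= m)%N -> irreducible_closed (c i)) ->
  (forall i, (i < m)%N -> c i `<` c i.+1) ->
  c m `<=` zariski_closure (rational_image a q) -> (m <= d)%N.
Proof.
move=> pa [q' qE] irrc cc cm; have /boolp.choice[a' aE] := pa 0.
have [A hA] := chain_independent irrc cc.
rewrite leqNgt; apply/negP => ltdm.
pose e := (\max_i msize (a' i) + msize q')%N.
(* with this t, the number t ^ (d + 1) exceeds ((A * e + 1) * t) ^ d *)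
pose t := ((A * e).+1 ^ d).+1.
have [I [g [cardI indg szg]]] := hA t.
pose gh i := homogenize a' q' (A * t) (g i).
have szgh i : (msize (gh i) <= (A * t * e).+1)%N.
  apply: msize_homogenize => //; last exact: leq_trans (leq_addl _ _) (leqnSn _).
  move=> j; apply/leqW/(leq_trans _ (leq_addr _ _)).
  exact: (leq_bigmax (F := fun j => msize (a' j))).
have [|l l0 [i /eqP]] := dependent_of_msize szgh.
  rewrite cardI; apply: (@leq_ltn_trans (((A * e).+1 * t) ^ d)).
    have [->|d_gt0] := posnP d; first by rewrite !expn0.
    by rewrite leq_exp2r // /t; move: (_ ^ d)%N => s; nia.
  rewrite expnMn; apply: (@leq_trans (t ^ d.+1)); last by rewrite leq_pexp2l.
  by rewrite expnS ltn_pmul2r ?expn_gt0.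
apply; apply: indg => x /cm Gx.
have -> : \sum_i l i * (g i).@[x 0] = (\sum_i l i *: g i).@[x 0].
  by rewrite raddf_sum; apply: eq_bigr => j _; rewrite /= mevalZ.
apply: Gx => _ [y /= nzq <-]; rewrite raddf_sum /=.
have nzq' : q'.@[y 0] != 0 by rewrite -qE.
have := congr1 (meval (y 0)) l0; rewrite meval0 raddf_sum /= => h.
apply: (mulfI (expf_neq0 (A * t) nzq')); rewrite mulr0 -[RHS]h mulr_sumr.
apply: eq_bigr => j _; rewrite !mevalZ meval_homogenize // mulrCA; congr (_ * (_ * _)).
by apply: meval_eq => s; rewrite mxE qE aE.
Qed.

End RationalImages.

(** * Local dimension and tangent spaces *)

Lemma card_le_dimv (K : fieldType) (V : vectType K) (U : {vspace V}) (I : finType)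
    (A : {set I}) (w : I -> V) :
  (forall i, i \in A -> w i \in U) ->
  (forall l : I -> K, \sum_(i in A) l i *: w i = 0 -> forall i, i \in A -> l i = 0) ->
  (#|A| <= \dim U)%N.
Proof.
move=> wU indw; have [->|[i0 i0A]] := set_0Vmem A; first by rewrite cards0.
have fw : free [seq w i | i <- enum A].
  apply/freeP => l l0 i.
  have := indw (fun j => l (enum_rank_in i0A j)) _ (enum_val i) (enum_valP i).
  rewrite enum_valK_in; apply; rewrite -[RHS]l0 big_enum_val /=.
  apply: eq_bigr => j _; rewrite enum_valK_in; congr (_ *: _).
  rewrite (nth_map (enum_val j)) -?cardE ?ltn_ord //.
  by congr w; apply: enum_val_nth.
rewrite cardE -(size_map w) -(eqP fw) dimvS //.
by apply/span_subvP => _ /mapP[i + ->]; rewrite mem_enum => /wU.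
Qed.

Section LocalGeometry.
Variable K : numFieldType.

Lemma polyfun_neq0_common N (f g : 'rV[K]_N -> K) y1 y2 :
  polyfun f -> polyfun g -> f y1 != 0 -> g y2 != 0 ->
  exists y, f y != 0 /\ g y != 0.
Proof.
move=> [p pE] [q qE] nzf nzg; apply: contrapT => /forallNP h.
have [P [PE _]] := restrict_line p y1 (y2 - y1).
have [Q [QE _]] := restrict_line q y1 (y2 - y1).
have : P * Q = 0.
  apply: poly_eq0_of_horner => t; rewrite hornerM PE QE -pE -qE.
  apply/eqP; rewrite mulf_eq0; have [//|ft] := eqVneq; have [//|gt] := eqVneq.
  by case: (h (y1 + t *: (y2 - y1))).
move/eqP; rewrite mulf_eq0 => /orP[] /eqP E.
  by move: nzf; rewrite pE -[y1]addr0 -(scale0r (y2 - y1)) -PE E horner0 eqxx.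
by move: nzg; rewrite qE -[y2](subrKC y1) -[y2 - y1]scale1r -QE E horner0 eqxx.
Qed.

(** A polynomial function on the target, pulled back along a / q and cleared of
    denominators. *)
Lemma rational_pullback d N (a : 'rV[K]_d -> 'rV[K]_N) q (p : {mpoly K[N]}) :
  polymx a -> polyfun q -> exists2 g, polyfun g &
    forall y, q y != 0 -> (g y == 0) = (p.@[((q y)^-1 *: a y) 0] == 0).
Proof.
move=> pa [q' qE]; have /boolp.choice[a' aE] := pa 0.
exists (fun y => (homogenize a' q' (msize p) p).@[y 0]); first exact: polyfun_meval.
move=> y nzq; have nzq' : q'.@[y 0] != 0 by rewrite -qE.
rewrite meval_homogenize // mulf_eq0 expf_eq0 (negPf nzq') andbF /=.
by congr (_ == 0); apply: meval_eq => i; rewrite mxE qE aE.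
Qed.

(** The closure of a rational image is irreducible because two points of affine
    space at which given polynomials do not vanish are joined by a line. *)
Lemma rational_image_irreducible d N (a : 'rV[K]_d -> 'rV[K]_N) q y0 :
  polymx a -> polyfun q -> q y0 != 0 ->
  irreducible_closed (zariski_closure (rational_image a q)).
Proof.
move=> pa pq nzq0; split; first exact: zariski_closure_closed.
  exists ((q y0)^-1 *: a y0); apply: subset_zariski_closure; by exists y0.
move=> A A' clA clA' CAA'.
have nsub B : zariski_closed B -> ~ zariski_closure (rational_image a q) `<=` B ->
    exists g y, [/\ polyfun g, g y != 0 &
      forall z, g z != 0 -> q z != 0 /\ ~ B ((q z)^-1 *: a z)].
  move=> clB /(contra_not (zariski_closure_sub clB)).
  move=> /existsNP[_ /not_implyP[[y nzq <-]]] /=.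
  have [S BS] := clB; rewrite {1}BS => /existsNP[p /not_implyP[Sp /eqP py]].
  have [g pg gE] := rational_pullback p pa pq.
  exists (fun z => g z * q z), y; split=> [||z].
  - exact: polyfunM.
  - by rewrite mulf_neq0 // gE.
  - rewrite mulf_eq0 negb_or => /andP[gz qz]; split=> //.
    by rewrite BS => /(_ p Sp)/eqP; rewrite -gE // (negPf gz).
apply: contrapT => /not_orP[/(nsub _ clA)[g [y [pg gy hg]]] /(nsub _ clA')[g' [y' [pg' gy' hg']]]].
have [z [/hg[qz Az] /hg'[_ A'z]]] := polyfun_neq0_common pg pg' gy gy'.
have Cz : zariski_closure (rational_image a q) ((q z)^-1 *: a z).
  by apply: subset_zariski_closure; exists z.
by case: (CAA' _ Cz).
Qed.

(** Near a point where h does not vanish only the closures of finitely many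
    rational images of affine spaces matter, and every irreducible subset of Z
    through the point lies in one of them. *)
Lemma chain_at_bound N (Z : set 'rV[K]_N) x (h : 'rV[K]_N -> K) (J : finType)
    (dm : J -> nat) (a : forall j, 'rV[K]_(dm j) -> 'rV[K]_N)
    (q : forall j, 'rV[K]_(dm j) -> K) D :
  polyfun h -> h x != 0 -> (forall j, polymx (a j)) -> (forall j, polyfun (q j)) ->
  (forall j, (dm j <= D)%N) ->
  (forall z, Z z -> h z != 0 -> exists j, rational_image (a j) (q j) z) ->
  forall m c, irreducible_chain_at Z x m c -> (m <= D)%N.
Proof.
move=> [p pE] hx pa pq dmD cover m c [irrc cc].
pose A (o : option J) := if o is Some j
  then zariski_closure (rational_image (a j) (q j)) else zero_locus [set p].
have [irrm cmZ cmx] := irrc m (leqnn m).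
have [||[j|] _ cmA] := irreducible_sub_bigcup (s := enum {: option J}) (A := A) irrm.
- by move=> [j|]; [apply: zariski_closure_closed | exists [set p]].
- move=> z /cmZ Zz; have [hz|/(cover z Zz)[j Gz]] := eqVneq (h z) 0.
    by exists None; rewrite ?mem_enum // => _ ->; rewrite -pE.
  by exists (Some j); rewrite ?mem_enum //; apply: subset_zariski_closure.
- apply: leq_trans (dmD j); apply: chain_length_rational_image cmA => // i im.
  by have [] := irrc i im.
by move: hx; rewrite pE (cmA _ cmx p erefl) eqxx.
Qed.

Lemma tangent_space_linear N (Z : set 'rV[K]_N) x c v w :
  tangent_space Z x v -> tangent_space Z x w -> tangent_space Z x (c *: v + w).
Proof.
move=> Tv Tw p Zp; under eq_bigr => i _ do rewrite !mxE mulrDr mulrCA.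
by rewrite big_split -mulr_sumr /= Tv // Tw // mulr0 addr0.
Qed.

(** Only finitely many points of the line may leave Z. *)
Lemma tangent_space_of_line N (Z : set 'rV[K]_N) x v (Q : {poly K}) :
  Q != 0 -> (forall t, Q.[t] != 0 -> Z (x + t *: v)) -> tangent_space Z x v.
Proof.
move=> nzQ QZ p Zp; have [P [PE <-]] := restrict_line p x v.
suff -> : P = 0 by rewrite coef0.
by apply: (poly_eq0_of_horner_neq0 nzQ) => t /QZ/Zp; rewrite PE.
Qed.

(** The linear term A of an equation of Z can be read off from its expansion along the
    line, without computing partial derivatives. *)
Lemma tangent_space_equation N m n (Z : set 'rV[K]_N) x v
    (F : 'rV[K]_N -> 'M[K]_(m, n)) A B :
  polymx F -> (forall z, Z z -> F z = 0) -> tangent_space Z x v ->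
  (forall t, F (x + t *: v) = t *: A + t ^+ 2 *: B) -> A = 0.
Proof.
move=> pF FZ Tv FE; apply/matrixP => i j; rewrite mxE.
have [p pE] := pF i j; have [P [PE P1]] := restrict_line p x v.
have : P = A i j *: 'X + B i j *: 'X^2.
  apply/eqP; rewrite -subr_eq0; apply/eqP/poly_eq0_of_horner => t.
  rewrite !hornerE PE -pE FE !mxE; apply/eqP; rewrite subr_eq0; apply/eqP.
  rewrite [A i j * t]mulrC; congr (_ + _); rewrite expr2 mulrC mulrA; reflexivity.
move/(congr1 (fun P : {poly K} => P`_1)); rewrite P1 Tv => [|z Zz].
  by rewrite coefD !coefZ coefX coefXn /= mulr1 mulr0 addr0.
by rewrite -pE FZ // mxE.
Qed.

Lemma tangent_dim_ge N (Z : set 'rV[K]_N) x (I : finType) (A : {set I})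
    (w : I -> 'rV[K]_N) d :
  tangent_dim Z x d -> (forall i, i \in A -> tangent_space Z x (w i)) ->
  (forall l : I -> K, \sum_(i in A) l i *: w i = 0 -> forall i, i \in A -> l i = 0) ->
  (#|A| <= d)%N.
Proof.
move=> [T [TE <-]] Tw; apply: card_le_dimv => i iA.
by have : [set` T] (w i) by rewrite TE; apply: Tw.
Qed.

End LocalGeometry.

(** * Grassmannian charts as rational images *)

Section Charts.
Variables (K : numFieldType) (k n : nat) (f : 'I_k -> 'I_n).

Definition normalize (B : 'M[K]_(k, n)) : 'M[K]_(k, n) :=
  invmx (colsub f B) *m B.

Lemma colsub_normalize B : colsub f B \in unitmx -> colsub f (normalize B) = 1%:M.
Proof. by move=> uB; rewrite -mulmx_colsub mulVmx. Qed.

Lemma normalize_mul (C : 'M_k) M : C \in unitmx -> colsub f M = 1%:M ->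
  colsub f (C *m M) \in unitmx /\ normalize (C *m M) = M.
Proof.
move=> uC M1; have CM1 : colsub f (C *m M) = C by rewrite -mulmx_colsub M1 mulmx1.
by rewrite /normalize CM1 mulmxA mulVmx ?mul1mx.
Qed.

Lemma colsub1_row_free (M : 'M[K]_(k, n)) : colsub f M = 1%:M -> row_free M.
Proof.
move=> M1; apply/row_freeP; exists (colsub f 1%:M).
by rewrite mulmx_colsub mulmx1.
Qed.

Section ChartImage.
Variables (d : nat) (B : 'rV[K]_d -> 'M[K]_(k, n)).

Definition chart_num y := mxvec (\adj (colsub f (B y)) *m B y).
Definition chart_den y := \det (colsub f (B y)).

(** Cramer's rule turns the normalization into a rational map with denominator the
    determinant of the selected columns. *)
Lemma rational_image_chart z : rational_image chart_num chart_den z <->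
  exists2 y, colsub f (B y) \in unitmx & z = mxvec (normalize (B y)).
Proof.
have E y : colsub f (B y) \in unitmx ->
    (chart_den y)^-1 *: chart_num y = mxvec (normalize (B y)).
  by move=> uB; rewrite /normalize /invmx uB -scalemxAl linearZ.
split=> [[y /= nz <-]|[y uB ->]]; exists y; rewrite ?E //= ?unitmxE ?unitfE //.
by rewrite -unitfE -unitmxE.
Qed.

Hypothesis pB : polymx B.

Lemma polymx_chart_num : polymx chart_num.
Proof.
by apply/polymx_mxvec/polymxM => //; apply/polymx_adj/polymx_colsub.
Qed.

Lemma polyfun_chart_den : polyfun chart_den.
Proof. exact/polyfun_det/polymx_colsub. Qed.

End ChartImage.
End Charts.

Section ClosedSets.
Variable K : numFieldType.

Lemma zariski_closedI N (A B : set 'rV[K]_N) :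
  zariski_closed A -> zariski_closed B -> zariski_closed (A `&` B).
Proof.
move=> [S ->] [T ->]; exists (S `|` T); apply/seteqP; split=> x /=.
  by move=> [Sx Tx] p [/Sx|/Tx].
by move=> h; split=> p Sp; apply: h; [left | right].
Qed.

Lemma zero_locus_polymx N (I : Type) m n (F : I -> 'rV[K]_N -> 'M[K]_(m, n)) :
  (forall i, polymx (F i)) -> zariski_closed [set x | forall i, F i x = 0].
Proof.
move=> pF; pose g (s : I * 'I_m * 'I_n) x := F s.1.1 x s.1.2 s.2.
have := @zero_locus_polyfun _ _ _ g (fun s => pF s.1.1 s.1.2 s.2).
congr zariski_closed; apply/seteqP; split=> x /= Fx.
  by move=> i; apply/matrixP => a b; rewrite [RHS]mxE; apply: (Fx (i, a, b)).
by move=> s; rewrite /g Fx mxE.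
Qed.

Lemma polyfun_scalar N m n (phi : {scalar 'M[K]_(m, n)}) (F : 'rV[K]_N -> 'M[K]_(m, n)) :
  polymx F -> polyfun (fun x => phi (F x)).
Proof.
move=> pF.
have h : polyfun (fun x => \sum_i \sum_j F x i j * phi (delta_mx i j)).
  apply: polyfun_sum => i; apply: polyfun_sum => j.
  by apply: polyfunM => //; apply: polyfun_cst.
apply: polyfun_ext h => x; rewrite {2}[F x]matrix_sum_delta linear_sum.
apply: eq_bigr => i _; rewrite linear_sum; apply: eq_bigr => j _.
by rewrite linearZ.
Qed.

Lemma mxtrace_idempotent n (E : 'M[K]_n) : E *m E = E -> \tr E = (\rank E)%:R.
Proof.
move=> EE; rewrite -{1}(mulmx_base E) mxtrace_mulC.
suff -> : row_base E *m col_base E = 1%:M by rewrite mxtrace1.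
have /row_fullP[C CE] := col_base_full E; have /row_freeP[R RE] := row_base_free E.
move: (mulmx_base E) CE RE; move: (col_base E) (row_base E) => c b cbE CE RE.
have : c *m b *m (c *m b) = c *m b by rewrite cbE.
move/(congr1 (fun A => C *m A *m R)) => /=; rewrite !mulmxA CE !mul1mx -!mulmxA RE.
by rewrite !mulmx1.
Qed.

End ClosedSets.

(** * Spaces graded by orthogonal idempotents *)

Section GradedSpaces.
Variables (K : numFieldType) (k n r : nat) (P : 'I_r -> 'M[K]_n) (ks : 'I_r -> nat).
Hypothesis PP : forall i j, P i *m P j = if i == j then P i else 0.
Variable f : 'I_k -> 'I_n.

(** The row space of M is the direct sum of its images under the idempotents P i,
    with prescribed dimensions: the matrix form of a Segre product. *)
Definition graded (M : 'M[K]_(k, n)) :=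
  [/\ forall i, (M *m P i <= M)%MS, M *m (\sum_i P i) = M &
      forall i, \rank (M *m P i) = ks i].

Definition graded_chart := [set mxvec M | M in [set M | colsub f M = 1%:M /\ graded M]].

Lemma graded_chartE M : graded_chart (mxvec M) <-> colsub f M = 1%:M /\ graded M.
Proof.
split=> [[M' hM' /(can_inj mxvecK) <-] //|hM]; by exists M.
Qed.

(** In a chart the stability of the row space is a polynomial equation, because the
    matrix by which P i acts on the rows can be read off the selected columns. *)
Lemma graded_colsub M i : colsub f M = 1%:M -> (M *m P i <= M)%MS ->
  M *m P i = colsub f (M *m P i) *m M.
Proof.
move=> M1 /submxP[E ME]; rewrite {1}ME; congr (_ *m M).
by rewrite ME -mulmx_colsub M1 mulmx1.
Qed.

(** On matrices stable under P i the rank of M P i is the trace of an idempotent, in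
    characteristic zero a polynomial condition. *)
Lemma graded_chart_closed : zariski_closed graded_chart.
Proof.
pose F1 (_ : unit) (x : 'rV_(k * n)) : 'M[K]_k := colsub f (vec_mx x) - 1%:M.
pose F2 i (x : 'rV_(k * n)) : 'M[K]_(k, n) :=
  vec_mx x *m P i - colsub f (vec_mx x *m P i) *m vec_mx x.
pose F3 (_ : unit) (x : 'rV_(k * n)) : 'M[K]_(k, n) :=
  vec_mx x *m (\sum_i P i) - vec_mx x.
pose F4 i (x : 'rV_(k * n)) : K :=
  \tr (colsub f (vec_mx x *m P i)) - (ks i)%:R.
have pvP A : polymx (fun x : 'rV[K]_(k * n) => vec_mx x *m A : 'M_(k, n)).
  by apply: polymxM; [apply: polymx_vec_mx | apply: polymx_cst].
have -> : graded_chart = [set x | forall i, F1 i x = 0] `&` [set x | forall i, F2 i x = 0]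
    `&` [set x | forall i, F3 i x = 0] `&` [set x | forall i, F4 i x = 0].
  have rk M i : colsub f M = 1%:M -> M *m P i = colsub f (M *m P i) *m M ->
      \tr (colsub f (M *m P i)) = (\rank (M *m P i))%:R.
    move=> M1 ME; rewrite {2}ME mxrankMfree ?(colsub1_row_free M1) //.
    apply: mxtrace_idempotent; set E := colsub f _.
    rewrite [in LHS]/E mulmx_colsub mulmxA -/E -ME -mulmxA PP eqxx.
    by [].
  apply/seteqP; split=> x /=.
    move=> [M [M1 [MP MS Mk]] <-]; rewrite /F1 /F2 /F3 /F4 mxvecK.
    split; first split; first split=> [_|i].
    - by rewrite M1 subrr.
    - by rewrite -graded_colsub // subrr.
    - by rewrite MS subrr.
    - by move=> i; rewrite rk // -?graded_colsub // Mk subrr.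
  move=> [[[/(_ tt)/subr0_eq M1 M2] /(_ tt)/subr0_eq M3] M4].
  have {}M2 i : vec_mx x *m P i = colsub f (vec_mx x *m P i) *m vec_mx x.
    exact: subr0_eq (M2 i).
  exists (vec_mx x); rewrite ?vec_mxK //; split=> //; split=> // i.
    by rewrite M2 submxMl.
  by apply/eqP; rewrite -(eqr_nat K) -rk //; apply/eqP/subr0_eq/(M4 i).
apply: zariski_closedI; last first.
  apply: zero_locus_polyfun => i; apply: polyfunB; last exact: polyfun_cst.
  by apply: polyfun_sum => j; apply: polymx_colsub.
apply: zariski_closedI; last first.
  by apply: zero_locus_polymx => ?; apply: polymxB => //; apply: polymx_vec_mx.
apply: zariski_closedI; apply: zero_locus_polymx => ?; apply: polymxB.
- exact/polymx_colsub/polymx_vec_mx.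
- exact: polymx_cst.
- by [].
- by apply: polymxM; [apply: polymx_colsub | apply: polymx_vec_mx].
Qed.
End GradedSpaces.

Section GradedSmooth.
Variables (K : numFieldType) (k n r : nat) (P : 'I_r -> 'M[K]_n) (ks : 'I_r -> nat).
Hypothesis PP : forall i j, P i *m P j = if i == j then P i else 0.
Variables (f : 'I_k -> 'I_n) (M0 : 'M[K]_(k, n)).
Hypotheses (M01 : colsub f M0 = 1%:M) (gM0 : graded P ks M0).

(** The matrix by which P i acts on the rows of M0. *)
Let E i := colsub f (M0 *m P i).

Let M0P i : M0 *m P i = E i *m M0.
Proof. by apply: graded_colsub => //; have [] := gM0. Qed.

Let sumEP (A : 'M[K]_(k, n)) : (forall i, A *m P i = E i *m A) ->
  A *m (\sum_i P i) = A /\ (\sum_i E i) *m A = A.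
Proof.
move=> AP; have sE : \sum_i E i = 1%:M.
  have [_ M0S _] := gM0.
  have : (\sum_i E i) *m M0 = M0.
    by rewrite mulmx_suml -{2}M0S mulmx_sumr; apply: eq_bigr => i _.
  move/(congr1 (colsub f)); rewrite -mulmx_colsub M01 mulmx1 => ->.
  by [].
rewrite sE mul1mx; split=> //; rewrite mulmx_sumr -[RHS]mul1mx -sE mulmx_suml.
exact: eq_bigr.
Qed.

Let EE i j : E i *m E j = if i == j then E i else 0.
Proof.
have : E i *m E j *m M0 = (if i == j then E i else 0) *m M0.
  rewrite -mulmxA -M0P mulmxA -M0P -mulmxA PP.
  by case: eqP => _; rewrite ?M0P ?mulmx0 ?mul0mx.
by move/(congr1 (colsub f)); rewrite -!mulmx_colsub M01 !mulmx1.
Qed.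

(** A right inverse of M0 that respects the gradings: the columns selected by f give
    one that need not, and this is its average over the idempotents. *)
Let S1 : 'M[K]_(n, k) := \sum_i P i *m (colsub f 1%:M *m E i).

Let M0S1 : M0 *m S1 = 1%:M.
Proof.
have [_ sE] := sumEP M0P.
have : \sum_i E i = 1%:M.
  by have := congr1 (colsub f) sE; rewrite -mulmx_colsub M01 mulmx1.
move=> <-; rewrite mulmx_sumr; apply: eq_bigr => i _.
by rewrite mulmxA M0P -mulmxA (mulmxA M0) (mulmx_colsub f M0) mulmx1 M01 mul1mx EE eqxx.
Qed.

Let PS1 j : P j *m S1 = S1 *m E j.
Proof.
rewrite mulmx_sumr mulmx_suml; apply: eq_bigr => i _.
rewrite mulmxA PP -!mulmxA EE eq_sym.
by case: eqVneq => [->|_] //; rewrite !mul0mx ?mulmx0.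
Qed.

(** The directions at M0 that respect the grading; they are the coordinates of a
    chart around M0 in which the condition to be graded is linear. *)
Let L : {vspace 'M[K]_(k, n)} :=
  (lker (linfun (mulmxr S1)) :&:
   \bigcap_i lker (linfun (mulmxr (P i) \- mulmx (E i))))%VS.

Let LP y : y \in L <-> y *m S1 = 0 /\ forall i, y *m P i = E i *m y.
Proof.
rewrite memv_cap memv_ker lfunE /=; split=> [/andP[/eqP yS]|[yS yP]].
  rewrite memvE => /subv_bigcapP h; split=> // i; apply: subr0_eq.
  by have := h i isT; rewrite -memvE memv_ker lfunE /= => /eqP.
rewrite yS eqxx memvE; apply/subv_bigcapP => i _.
by rewrite -memvE memv_ker lfunE /= yP subrr.
Qed.

Let d := \dim L.
Let b := vbasis L.
Let B (j : nat) (y : 'rV[K]_d) := M0 + \sum_(s < d | (s < j)%N) y 0 s *: b`_s.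
Let X := graded_chart P ks f.

Let polymx_B j : polymx (B j).
Proof.
apply: polymxD; first exact: polymx_cst.
move=> a c; have h : polyfun (fun y : 'rV[K]_d => \sum_(s < d | (s < j)%N) y 0 s * b`_s a c).
  by apply: polyfun_sum => s; apply: polyfunM; [apply: polyfun_coord | apply: polyfun_cst].
apply: polyfun_ext h => y; rewrite summxE; apply: eq_bigr => s _.
by rewrite mxE.
Qed.

Let B_in j y : B j y - M0 \in L.
Proof.
rewrite addrC addKr; apply: memv_suml => s _; apply: memvZ.
by apply: vbasis_mem; rewrite mem_nth // size_tuple.
Qed.

(** Near M0 the chart f and the linear chart N *m S1 = 1 parametrize the same graded
    spaces: normalization leads from the second to the first. *)
Let normalize_in N : N - M0 \in L -> colsub f N \in unitmx -> X (mxvec (normalize f N)).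
Proof.
move=> /LP[NS1 NP] uN; apply/graded_chartE; split; first exact: colsub_normalize.
have {}NP i : N *m P i = E i *m N.
  by have := NP i; rewrite mulmxBl mulmxBr M0P => /addIr.
have {}NS1 : N *m S1 = 1%:M.
  by move: NS1; rewrite mulmxBl M0S1 => /subr0_eq.
have rfM (A : 'M_(k, n)) : A *m S1 = 1%:M -> row_free A by move=> h; apply/row_freeP; exists S1.
have uI : invmx (colsub f N) \in unitmx by rewrite unitmx_inv.
split=> [i||i].
- rewrite /normalize -mulmxA NP !mulmxA; apply: submx_trans (submxMl _ N) _.
  by rewrite -{1}(mulKVmx uN N) submxMl.
- by rewrite /normalize -mulmxA; have [-> _] := sumEP NP.
have [_ _ <-] := gM0; rewrite /normalize -mulmxA.
rewrite -[LHS]mxrank_tr trmx_mul mxrankMfree; last by rewrite row_free_unit unitmx_tr.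
by rewrite mxrank_tr NP M0P !mxrankMfree // rfM.
Qed.

Let h z := \det (vec_mx z *m S1 : 'M[K]_k).

Let polyfun_h : polyfun h.
Proof.
by apply/polyfun_det/polymxM; [apply: polymx_vec_mx | apply: polymx_cst].
Qed.

(** Conversely, where M *m S1 is invertible its inverse brings M into the linear chart. *)
Let cover z : X z -> h z != 0 -> exists2 y, colsub f (B d y) \in unitmx &
  z = mxvec (normalize f (B d y)).
Proof.
move=> [M [M1 [MP MS _]] <-]; rewrite /h mxvecK -unitfE -unitmxE => uM.
have uI : invmx (M *m S1) \in unitmx by rewrite unitmx_inv.
pose N := invmx (M *m S1) *m M; have [uN nN] := normalize_mul uI M1.
have NL : N - M0 \in L.
  apply/LP; rewrite mulmxBl M0S1 /N -mulmxA mulVmx // subrr; split=> // i.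
  have ME := graded_colsub M1 (MP i).
  rewrite mulmxBl mulmxBr M0P -/N; congr (_ - _).
  have NPi : N *m P i = invmx (M *m S1) *m colsub f (M *m P i) *m (M *m S1) *m N.
    rewrite -[RHS]mulmxA [in RHS]/N mulKVmx // /N -mulmxA {1}ME.
    by rewrite mulmxA.
  rewrite NPi; congr (_ *m _).
  have := congr1 (mulmx^~ S1) NPi; rewrite /= -!mulmxA PS1 !mulmxA.
  by rewrite -[N *m S1]mulmxA mulVmx // mul1mx -!mulmxA mulVmx // mulmx1 => ->.
pose y : 'rV_d := \row_s coord b s (N - M0).
suff By : B d y = N by exists y; rewrite By // [normalize f N]nN.
rewrite /B -[RHS](subrKC M0); congr (_ + _); rewrite [RHS](coord_vbasis NL).
by apply: eq_big => s; rewrite ?ltn_ord // mxE.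
Qed.

Let B0 j : B j 0 = M0.
Proof. by rewrite /B big1 ?addr0 // => s _; rewrite mxE scale0r. Qed.

Let img j := rational_image (chart_num f (B j)) (chart_den f (B j)).

Let img_sub j : img j `<=` X.
Proof. by move=> z /rational_image_chart[y uB ->]; apply: normalize_in. Qed.

Let img_M0 j : img j (mxvec M0).
Proof.
apply/rational_image_chart; exists 0; rewrite B0 ?M01 ?unitmx1 //.
by rewrite /normalize M01 invmx1 mul1mx.
Qed.

Let img_leq j : img j `<=` img j.+1.
Proof.
move=> z /rational_image_chart[y uB ->]; apply/rational_image_chart.
suff [y' By'] : exists y', B j.+1 y' = B j y by exists y'; rewrite By'.
exists (\row_s (if (s < j)%N then y 0 s else 0)); congr (_ + _).
rewrite (bigID (fun s : 'I_d => (s < j)%N)) /= [X in _ + X]big1 ?addr0.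
  by apply: eq_big => [s|s /andP[_ sj]]; rewrite ?mxE ?sj // ltnS andb_idl // => /ltnW.
by move=> s /andP[_ /negPf sj]; rewrite mxE sj scale0r.
Qed.

(** Up to the nonzero factor \det (M *m S1), the j-th coordinate of the point of the
    linear chart that corresponds to M. *)
Let co (j : 'I_d) z : K :=
  coord b j (\adj (vec_mx z *m S1) *m vec_mx z - h z *: M0).

Let polyfun_co j : polyfun (co j).
Proof.
apply: (polyfun_scalar (coord b j)); apply: polymxB.
  apply: polymxM; last exact: polymx_vec_mx.
  by apply/polymx_adj/polymxM; [apply: polymx_vec_mx | apply: polymx_cst].
by apply: polymxZ => //; apply: polymx_cst.
Qed.

Let coE i (j : 'I_d) y : colsub f (B i y) \in unitmx ->
  (co j (mxvec (normalize f (B i y))) == 0) = ((i <= j)%N || (y 0 j == 0)).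
Proof.
move=> uB; rewrite /co /h mxvecK.
have /LP[BS _] := B_in i y; move: BS; rewrite mulmxBl M0S1 => /subr0_eq BS.
set A := colsub f _ in uB.
have -> : normalize f (B i y) *m S1 = invmx A by rewrite /normalize -mulmxA BS mulmx1.
have uI : invmx A \in unitmx by rewrite unitmx_inv.
have -> : \adj (invmx A) *m normalize f (B i y) = \det (invmx A) *: B i y.
  by rewrite /normalize -/A mulmxA mul_adj_mx mul_scalar_mx.
rewrite -scalerBr linearZ /= mulf_eq0.
have -> : \det (invmx A) == 0 = false by apply/negbTE; rewrite -unitfE -unitmxE.
rewrite /= /B addrC addKr linear_sum /=.
rewrite (eq_bigr (fun s => y 0 s * (s == j)%:R)) => [|s _]; last first.
  by rewrite linearZ /= coord_free ?(basis_free (vbasisP _)) // eq_sym.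
have [ij|ji] := leqP i j.
  rewrite big1 ?eqxx // => s si; have [sj|] := eqVneq s j; last by rewrite mulr0.
  by move: si; rewrite sj ltnNge ij.
by rewrite (bigD1 j) //= big1 ?eqxx ?addr0 ?mulr1 // => s /andP[_ /negPf->]; rewrite mulr0.
Qed.

(** The images of a flag of coordinate subspaces of L, told apart by the functions co. *)
Let chain_M0 : irreducible_chain_at X (mxvec M0) d (fun j => zariski_closure (img j)).
Proof.
split=> [j _|j jd].
  split; last exact/subset_zariski_closure/img_M0.
    apply: (rational_image_irreducible (y0 := 0)).
    - exact/polymx_chart_num.
    - exact/polyfun_chart_den.
    - by rewrite /chart_den B0 M01 det1 oner_eq0.
  by apply: zariski_closure_sub (@img_sub j); apply: graded_chart_closed.
split.
  apply: zariski_closure_sub; first exact: zariski_closure_closed.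
  by apply: subset_trans (@img_leq j) _; apply: subset_zariski_closure.
move=> sub; have [p pE] := polyfun_co (Ordinal jd).
have p0 : vanishing_ideal (img j) p.
  move=> z /rational_image_chart[y uB ->]; rewrite -pE; apply/eqP.
  by rewrite coE // leqnn.
have [||||y [yj yB]] := @polyfun_neq0_common _ d (fun y => y 0 (Ordinal jd))
    (chart_den f (B j.+1)) (const_mx 1) 0.
- exact: polyfun_coord.
- exact/polyfun_chart_den.
- by rewrite mxE oner_eq0.
- by rewrite /chart_den B0 M01 det1 oner_eq0.
have uB : colsub f (B j.+1 y) \in unitmx by rewrite unitmxE unitfE.
have /sub/(_ p p0)/eqP : zariski_closure (img j.+1) (mxvec (normalize f (B j.+1 y))).
  by apply/subset_zariski_closure/rational_image_chart; exists y.
by rewrite -pE coE //= ltnn (negPf yj).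
Qed.

Let local_dim_M0 : local_dim X (mxvec M0) d.
Proof.
split; first by exists (fun j => zariski_closure (img j)); apply: chain_M0.
apply: (@chain_at_bound _ _ _ _ h unit (fun=> d) (fun=> chart_num f (B d))
  (fun=> chart_den f (B d))) => // [|_|_|z Xz hz].
- by rewrite /h mxvecK M0S1 det1 oner_eq0.
- exact: polymx_chart_num.
- exact: polyfun_chart_den.
- by exists tt; apply/rational_image_chart; apply: cover.
Qed.

(** The tangent vector at M0 of the image in the chart f of the line M0 + t y. *)
Let theta (y : 'M[K]_(k, n)) := mxvec (y - colsub f y *m M0).

Let theta_lin : linear theta.
Proof.
move=> a y z; rewrite /theta -linearZ -linearD /=; congr mxvec.
rewrite linearP /= mulmxDl -scalemxAl scalerBr addrACA -opprD.
by [].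
Qed.

Let th : {linear 'M[K]_(k, n) -> 'rV[K]_(k * n)} :=
  HB.pack theta (GRing.isLinear.Build _ _ _ _ theta theta_lin).

(** A direction of rank one is tangent: the line M0 + t y maps onto the line of
    direction theta y, up to a change of parameter. *)
Let theta_rank1 (u : 'cV[K]_k) (v : 'rV[K]_n) : u *m v \in L ->
  tangent_space X (mxvec M0) (theta (u *m v)).
Proof.
set z := u *m v => zL; pose c := (colsub f v *m u) 0 0.
have zz : colsub f z *m z = c *: z.
  rewrite /z -mulmx_colsub -!mulmxA [_ *m (u *m v)]mulmxA [colsub f v *m u]mx11_scalar.
  by rewrite mul_scalar_mx -scalemxAr.
apply: (@tangent_space_of_line _ _ _ _ _ (1 - c *: 'X)).
  by apply/eqP => /(congr1 (fun Q => Q.[0])); rewrite !hornerE ?mulr0 ?subr0; apply/eqP/oner_neq0.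
move=> t; rewrite !hornerE => nzt.
(* the scalar for which (1 - t z_f) (M0 + s z) is affine in t; recall z_f z = c z *)
pose s := t / (1 - c * t).
pose N := M0 + s *: z; have NL : N - M0 \in L by rewrite addrC addKr memvZ.
have E1 : (1%:M - t *: colsub f z) *m N = M0 + t *: (z - colsub f z *m M0).
  rewrite mulmxBl mul1mx /N mulmxDr -!scalemxAl -scalemxAr zz.
  move: (colsub f z *m M0) (z) => w z0; apply/matrixP => i j; rewrite !mxE.
  have sE : s * (1 - c * t) - t = 0 by rewrite divfK ?subrr.
  apply: subr0_eq; transitivity ((s * (1 - c * t) - t) * z0 i j); first by ring.
  by rewrite sE mul0r.
have N1 : (1%:M - t *: colsub f z) *m colsub f N = 1%:M.
  rewrite mulmx_colsub E1; apply/matrixP => i j.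
  have /matrixP/(_ i j) : colsub f (colsub f z *m M0) = colsub f z.
    by rewrite -mulmx_colsub M01 mulmx1.
  by rewrite -M01 !mxE => ->; rewrite subrr mulr0 addr0.
have [uQ uN] := mulmx1_unit N1.
rewrite /theta -linearZ -linearD /= -E1.
suff -> : (1%:M - t *: colsub f z) *m N = normalize f N by apply: normalize_in.
by rewrite /normalize; congr (_ *m N); rewrite -[LHS](mulmxK uN) N1 mul1mx.
Qed.

(** The image of y under all the idempotents being y itself, the decomposition of y
    into matrix units gives elements of rank one in L that add up to y. *)
Let theta_tangent y : y \in L -> tangent_space X (mxvec M0) (theta y).
Proof.
move=> yL; have /LP[yS yP] := yL.
pose C : 'M[K]_n := 1%:M - S1 *m M0.
pose W i a c : 'M[K]_(k, n) :=
  (E i *m delta_mx a (0 : 'I_1)) *m (delta_mx (0 : 'I_1) c *m (P i *m C)).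
have PC i : P i *m C = C *m P i.
  by rewrite mulmxBl mulmxBr mulmx1 mul1mx mulmxA PS1 -!mulmxA M0P.
have WL i a c : W i a c \in L.
  apply/LP; split=> [|j]; rewrite /W.
    by rewrite -!mulmxA mulmxBl mul1mx -[S1 *m M0 *m S1]mulmxA M0S1 mulmx1 subrr !mulmx0.
  rewrite PC -!mulmxA PP !mulmxA EE [j == i]eq_sym.
  by case: eqP => [->|_] //; rewrite !mulmx0 !mul0mx.
have yE : y = \sum_i \sum_a \sum_c y a c *: W i a c.
  have yC : y *m C = y by rewrite mulmxBr mulmx1 mulmxA yS mul0mx subr0.
  have [ySP _] := sumEP yP.
  rewrite -{1}ySP mulmx_sumr; apply: eq_bigr => i _.
  have -> : y *m P i = E i *m y *m (P i *m C).
    by rewrite PC mulmxA -[E i *m y *m C]mulmxA yC -yP -mulmxA PP eqxx.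
  rewrite {1}[y]matrix_sum_delta mulmx_sumr mulmx_suml; apply: eq_bigr => a _.
  rewrite mulmx_sumr mulmx_suml; apply: eq_bigr => c _.
  rewrite -scalemxAr -scalemxAl /W -!mulmxA; congr (_ *: _).
  by rewrite !mulmxA -[_ *m delta_mx a 0 *m _]mulmxA mul_delta_mx.
have th0 : tangent_space X (mxvec M0) 0.
  by move=> p _; rewrite big1 // => i _; rewrite mxE mulr0.
rewrite -[theta y]/(th y) {1}yE linear_sum /=.
apply: big_ind => [//|u v Tu Tv|i _].
  by rewrite -[u]scale1r; apply: tangent_space_linear.
rewrite -[theta _]/(th _) linear_sum /=.
apply: big_ind => [//|u v Tu Tv|a _].
  by rewrite -[u]scale1r; apply: tangent_space_linear.
rewrite -[theta _]/(th _) linear_sum /=.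
apply: big_ind => [//|u v Tu Tv|c _].
  by rewrite -[u]scale1r; apply: tangent_space_linear.
rewrite -[theta _]/(th _) linearZ /= -[_ *: _]addr0.
by apply: tangent_space_linear => //; apply: theta_rank1; apply: WL.
Qed.

(** Differentiating the quadratic equations M P i = (M P i)_f M at M0 along v shows
    that v - v S1 M0 lies in L. *)
Let tangent_theta v : tangent_space X (mxvec M0) v ->
  exists2 y, y \in L & v = theta y.
Proof.
move=> Tv; pose w : 'M[K]_(k, n) := vec_mx v.
have vE : v = mxvec w by rewrite vec_mxK.
have lineE t : vec_mx (mxvec M0 + t *: v) = M0 + t *: w :> 'M_(k, n).
  by rewrite linearD linearZ /= mxvecK.
have w1 : colsub f w = 0.
  apply: (@tangent_space_equation _ _ _ _ X (mxvec M0) v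
    (fun z => colsub f (vec_mx z) - 1%:M) _ 0) => [||//|t].
  - by apply: polymxB; [apply/polymx_colsub/polymx_vec_mx | apply: polymx_cst].
  - by move=> z [M [M1 _] <-]; rewrite mxvecK M1 subrr.
  by rewrite lineE -M01 scaler0 addr0; apply/matrixP => a c; rewrite !mxE addrC addKr.
have wP i : w *m P i - colsub f (w *m P i) *m M0 - E i *m w = 0.
  apply: (@tangent_space_equation _ _ _ _ X (mxvec M0) v
    (fun z => vec_mx z *m P i - colsub f (vec_mx z *m P i) *m vec_mx z) _
    (- (colsub f (w *m P i) *m w))) => [||//|t].
  - have pvP : polymx (fun x : 'rV[K]_(k * n) => vec_mx x *m P i : 'M_(k, n)).
      by apply: polymxM; [apply: polymx_vec_mx | apply: polymx_cst].
    apply: polymxB => //; apply: polymxM; last exact: polymx_vec_mx.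
    exact: polymx_colsub.
  - move=> z [M [M1 [MP _ _]] <-]; rewrite mxvecK.
    by rewrite {1}(graded_colsub M1 (MP i)) subrr.
  rewrite lineE mulmxDl -scalemxAl.
  have -> : colsub f (M0 *m P i + t *: (w *m P i)) = E i + t *: colsub f (w *m P i).
    by apply/matrixP => a c; rewrite !mxE.
  rewrite mulmxDl !mulmxDr -!scalemxAl -!scalemxAr M0P.
  move: (E i *m M0) (w *m P i) (E i *m w) (colsub f _ *m M0) (colsub f _ *m w).
  by move=> m1 m2 m3 m4 m5; apply/matrixP => a c; rewrite !mxE; ring.
pose y := w - w *m S1 *m M0.
have yS : y *m S1 = 0 by rewrite mulmxBl -[w *m S1 *m M0 *m S1]mulmxA M0S1 mulmx1 subrr.
have yL : y \in L.
  apply/LP; split=> // i; apply: subr0_eq.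
  pose Q := colsub f (w *m P i) - w *m S1 *m E i + E i *m w *m S1.
  have QE : y *m P i - E i *m y = Q *m M0.
    have := subr0_eq (wP i) => {}wPi.
    rewrite mulmxBl mulmxBr -[_ *m M0 *m P i]mulmxA M0P -wPi /Q.
    rewrite mulmxDl mulmxBl !mulmxA.
    move: (w *m P i) (colsub f (w *m P i) *m M0) => m1 m2.
    by apply/matrixP => a c; rewrite !mxE; ring.
  have : Q *m M0 *m S1 = 0.
    by rewrite -QE mulmxBl -!mulmxA PS1 yS mulmx0 mulmxA yS mul0mx subrr.
  by rewrite QE -mulmxA M0S1 mulmx1 => ->; rewrite mul0mx.
exists y; rewrite // vE /theta; congr mxvec.
have -> : colsub f y = - (w *m S1).
  have /matrixP w1' := w1; apply/matrixP => a c.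
  have /matrixP/(_ a c) : colsub f (w *m S1 *m M0) = w *m S1.
    by rewrite -mulmx_colsub M01 mulmx1.
  by have := w1' a c; rewrite !mxE => -> ->; rewrite sub0r.
by rewrite mulNmx opprK /y subrK.
Qed.

Let tangent_dim_M0 : tangent_dim X (mxvec M0) d.
Proof.
exists (linfun th @: L)%VS; split.
  apply/seteqP; split=> v /=.
    move=> /memv_imgP[y yL ->]; rewrite (lfunE th y); apply: theta_tangent; exact: yL.
  move=> Tv; have [y yL ->] := tangent_theta Tv.
  by apply/memv_imgP; exists y; [exact: yL | rewrite (lfunE th y)].
apply: limg_dim_eq; apply/eqP; rewrite -subv0; apply/subvP => y.
move=> /memv_capP[/LP[yS _]]; rewrite memv_ker (lfunE th y) /= => /eqP th0.
have /subr0_eq yE : y - colsub f y *m M0 = 0.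
  by apply: (can_inj mxvecK); rewrite [LHS]th0 linear0.
move: yS; rewrite yE -mulmxA M0S1 mulmx1 => y0. by rewrite y0 mul0mx memv0.
Qed.

Lemma graded_chart_smooth_at : smooth_at (graded_chart P ks f) (mxvec M0).
Proof. by exists d; split; [apply: local_dim_M0 | apply: tangent_dim_M0]. Qed.

End GradedSmooth.

(** * Row spans *)

Section RowSpan.
Variables (K : fieldType) (V : vectType K).
Local Notation n := (\dim {:V}).
Variable e : n.-tuple V.
Hypothesis he : basis_of fullv e.

Lemma row_spanE k (M : 'M[K]_(k, n)) :
  row_span e M = <<[seq vecof e (row i M) | i : 'I_k]>>%VS.
Proof.
congr <<_>>%VS; apply: eq_map => i; apply: eq_bigr => j _.
by rewrite mxE.
Qed.

Lemma mem_row_span k (M : 'M[K]_(k, n)) x :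
  (x \in row_span e M) = (rVof e x <= M)%MS.
Proof.
rewrite row_spanE; apply/idP/submxP => [|[u xE]].
  suff /subvP h : (<<[seq vecof e (row i M) | i : 'I_k]>> <= vsof e <<M>>%MS)%VS.
    by move/h; rewrite -rVof_sub // genmxE => /submxP.
  apply/span_subvP => _ /mapP[i _ ->].
  by rewrite -rVof_sub // vecofK // genmxE row_sub.
rewrite -(rVofK he x) xE mulmx_sum_row linear_sum; apply: memv_suml => i _.
rewrite linearZ memvZ // memv_span //; apply/mapP; exists i => //.
by rewrite mem_enum.
Qed.

Lemma row_span_sub k m (A : 'M[K]_(k, n)) (B : 'M[K]_(m, n)) :
  (row_span e A <= row_span e B)%VS = (A <= B)%MS.
Proof.
apply/subvP/idP => [h|AB x]; last by rewrite !mem_row_span => /submx_trans; apply.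
apply/row_subP => i; rewrite -[row i A](vecofK he) -mem_row_span; apply: h.
by rewrite mem_row_span vecofK // row_sub.
Qed.

Lemma dim_row_span k (A : 'M[K]_(k, n)) : \dim (row_span e A) = \rank A.
Proof.
have -> : row_span e A = row_span e (row_base A).
  by apply/eqP; rewrite eqEsubv !row_span_sub !eq_row_base !submx_refl.
move: (\rank A) (row_base A) (row_base_free A) => m B fB.
rewrite row_spanE; set s := [seq _ | _ : _].
have sz : size s = m by rewrite size_map -cardE card_ord.
have : free (tcast sz (in_tuple s)).
  apply/freeP => l l0 i.
  suff : \row_i l i *m B == 0 by rewrite mulmx_free_eq0 // => /eqP/rowP/(_ i); rewrite !mxE.
  apply/eqP/(can_inj (vecofK he)); rewrite linear0 mulmx_sum_row linear_sum.
  rewrite -[RHS]l0; apply: eq_bigr => j _; rewrite linearZ mxE /= val_tcast /=.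
  congr (_ *: _); rewrite /s (nth_map j) ?size_enum_ord // -?cardE ?card_ord //.
  by rewrite nth_ord_enum.
by rewrite /free val_tcast /= sz => /eqP.
Qed.

Lemma row_span_img k (M : 'M[K]_(k, n)) (phi : 'End(V)) :
  row_span e (M *m mxof e e phi) = (phi @: row_span e M)%VS.
Proof.
apply/vspaceP => x; rewrite mem_row_span.
apply/submxP/memv_imgP => [[u xE]|[y]].
  exists (vecof e (u *m M)); first by rewrite mem_row_span vecofK // submxMl.
  by apply: (can_inj (rVofK he)); rewrite (rVof_app e he) vecofK // xE mulmxA.
rewrite mem_row_span => /submxP[u yE] ->; exists u.
by rewrite (rVof_app e he) yE mulmxA.
Qed.

End RowSpan.

(** * Segre products are smooth *)

Section SegreSmooth.
Variables (K : numFieldType) (V : vectType K).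
Local Notation n := (\dim {:V}).
Variable e : n.-tuple V.
Hypothesis he : basis_of fullv e.
Variables (r : nat) (ks : 'I_r -> nat) (Vs : 'I_r -> {vspace V}).
Hypothesis dV : directv (\sum_(i < r) Vs i)%VS.

Let pi i : 'End(V) := sumv_pi (\sum_(i < r) Vs i)%VS i.
Let P i := mxof e e (pi i).

Let pi_mem i x : pi i x \in Vs i. Proof. exact: memv_sum_pi. Qed.

Let pi_sum x : x \in (\sum_(i < r) Vs i)%VS -> \sum_i pi i x = x.
Proof. exact: sumv_pi_sum. Qed.

Let pi_sum_mem i (w : 'I_r -> V) : (forall j, w j \in Vs j) -> pi i (\sum_j w j) = w i.
Proof.
move=> wV; have := directv_sum_unique dV (fun j => pi j (\sum_j w j)) w.
move/(_ (fun j _ => pi_mem _ _) (fun j _ => wV j)).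
rewrite pi_sum ?eqxx; last by apply: memv_sumr => j _.
by move/esym/forall_inP/(_ i isT)/eqP.
Qed.

Let pi_on i j x : x \in Vs j -> pi i x = if j == i then x else 0.
Proof.
move=> xV; rewrite -{1}[x](_ : \sum_l (if j == l then x else 0) = x).
  by rewrite pi_sum_mem // => l; case: eqP => [<-|_]; rewrite ?mem0v.
by rewrite (bigD1 j) //= eqxx big1 ?addr0 // => l; rewrite eq_sym => /negPf->.
Qed.

Let PP i j : P i *m P j = if i == j then P i else 0.
Proof.
rewrite /P -mxof_comp //.
have -> : (pi j \o pi i)%VF = if i == j then pi i else 0.
  apply/lfunP => x; rewrite comp_lfunE (pi_on _ (pi_mem i x)).
  by case: eqP; rewrite ?lfunE.
by case: eqP => // _; rewrite linear0.
Qed.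

Let rVof_sumP y : rVof e y *m (\sum_i P i) = rVof e (\sum_i pi i y).
Proof.
by rewrite mulmx_sumr linear_sum; apply: eq_bigr => i _; rewrite /= (rVof_app e he).
Qed.

(** The summands W i are the images of their sum under the projections pi i. *)
Lemma segre_product_graded k (M : 'M[K]_(k, n)) :
  segre_product ks Vs (row_span e M) <-> graded P ks M.
Proof.
split=> [[W WV /esym ME]|[MP MS Mk]].
  have piM i : (pi i @: row_span e M)%VS = W i.
    have WVs j : (W j <= Vs j)%VS by have [] := WV j.
    apply/vspaceP => x; apply/memv_imgP/idP => [[y]|xW].
      rewrite ME => /memv_sumP[w wW ->] ->; rewrite pi_sum_mem => [|j]; first exact: wW.
      exact/(subvP (WVs j))/wW.
    exists x; first by rewrite ME; apply: (subvP (sumv_sup i _ (subvv _))).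
    by rewrite (pi_on _ (subvP (WVs i) _ xW)) eqxx.
  split=> [i||i].
  - by rewrite -(row_span_sub he) row_span_img // piM ME (sumv_sup i).
  - apply/row_matrixP => i; rewrite row_mul -[row i M](vecofK he) rVof_sumP pi_sum //.
    have : vecof e (row i M) \in row_span e M by rewrite mem_row_span // vecofK // row_sub.
    apply/subvP; rewrite ME; apply/subv_sumP => j _; apply: (sumv_sup j) => //.
    by have [] := WV j.
  - by rewrite -(dim_row_span he) row_span_img // piM; have [] := WV i.
exists (fun i => row_span e (M *m P i)).
  move=> i; split; last by rewrite /grassmannian /= dim_row_span.
  rewrite row_span_img //; apply/subvP => _ /memv_imgP[y _ ->]; exact: pi_mem.
apply/eqP; rewrite eqEsubv; apply/andP; split.
  by apply/subv_sumP => i _; rewrite row_span_sub.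
apply/subvP => y; rewrite mem_row_span // => /submxP[u yE].
have -> : y = \sum_i pi i y.
  by apply: (can_inj (rVofK he)); rewrite -rVof_sumP yE -mulmxA MS.
apply: memv_sumr => i _; rewrite row_span_img //; apply: memv_img.
by rewrite mem_row_span // yE submxMl.
Qed.

Lemma segre_product_smooth k : smooth_subvariety e k (segre_product ks Vs).
Proof.
move=> f _ x.
have -> : chart_part e f (segre_product ks Vs) = graded_chart P ks f.
  by apply/seteqP; split=> _ [M [M1 /segre_product_graded hM] <-]; exists M.
by move=> [M [M1 gM] <-]; apply: graded_chart_smooth_at.
Qed.

End SegreSmooth.

(** * Flags and bases adapted to two opposite flags *)

Lemma dim_cap_flagF_step (K : fieldType) (V : vectType K) n (e : n.-tuple V) (U : {vspace V}) i :
  (\dim (U :&: flagF e i.+1) <= (\dim (U :&: flagF e i)).+1)%N.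
Proof.
set A := (U :&: flagF e i.+1)%VS.
have Fstep : flagF e i.+1 = (flagF e i + <<take 1 (drop i e)>>)%VS.
  by rewrite /flagF -addn1 takeD span_cat.
have F1 : (\dim (flagF e i.+1) <= (\dim (flagF e i)).+1)%N.
  rewrite Fstep; apply: leq_trans (dimv_add_leqif _ _) _.
  rewrite -[leqRHS]addn1 leq_add2l; apply: leq_trans (dim_span _) _.
  by rewrite size_take_min geq_minl.
have := dimv_sum_cap A (flagF e i).
have : (\dim (A + flagF e i) <= \dim (flagF e i.+1))%N.
  by apply: dimvS; rewrite subv_add capvSr /= Fstep addvSl.
have -> : (A :&: flagF e i = U :&: flagF e i)%VS.
  rewrite /A -capvA; congr (_ :&: _)%VS; apply/capv_idPr.
  by rewrite Fstep addvSl.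
move: F1; move: (\dim (U :&: _)) => x; lia.
Qed.

Section Flags.
Variables (K : fieldType) (V : vectType K) (n : nat) (e : n.-tuple V).

Lemma flagG_rev i : flagG e i = flagF [tuple of rev e] i.
Proof. by []. Qed.

Lemma dim_cap_flagG_step (U : {vspace V}) i :
  (\dim (U :&: flagG e i.+1) <= (\dim (U :&: flagG e i)).+1)%N.
Proof. exact: (dim_cap_flagF_step [tuple of rev e]). Qed.

Lemma rev_basis : basis_of fullv e -> basis_of fullv [tuple of rev e].
Proof.
by have /permPl pe := perm_rev e; rewrite (perm_basis fullv pe).
Qed.

Lemma tnth_rev (l : 'I_n) : (rev e)`_l = e`_(rev_ord l).
Proof. by rewrite nth_rev size_tuple. Qed.

Hypothesis he : basis_of fullv e.

Lemma coord_nth (i j : 'I_n) : coord e i e`_j = (i == j)%:R.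
Proof. by rewrite coord_free ?(basis_free he) // eq_sym. Qed.

Lemma mem_span_coord (s : seq V) (A : pred 'I_n) x :
  (forall y, y \in s -> exists2 l : 'I_n, A l & y = e`_l) ->
  (forall l : 'I_n, A l -> e`_l \in s) ->
  (x \in <<s>>%VS) = [forall l, (coord e l x != 0) ==> A l].
Proof.
move=> sA As; apply/idP/forallP => [xs l|xA].
  apply/implyP; apply: contraR => nAl.
  rewrite -[s]/(val (in_tuple s)) in xs; rewrite (coord_span xs) linear_sum big1 // => j _.
  have /sA[i Ai ->] : (in_tuple s)`_j \in s by rewrite mem_nth.
  rewrite linearZ /= coord_nth; case: eqP nAl Ai => [->/negPf->|_ _ _] //.
  by rewrite mulr0.
rewrite (coord_basis he (memvf x)); apply: memv_suml => l _.
have [->|nz] := eqVneq (coord e l x) 0; first by rewrite scale0r mem0v.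
by apply/memvZ/memv_span/As/(implyP (xA l)).
Qed.

Lemma mem_flagF i x :
  (x \in flagF e i) = [forall l : 'I_n, (coord e l x != 0) ==> (l < i)%N].
Proof.
apply: mem_span_coord => [y|l li].
  case/(nthP 0) => j; rewrite size_take_min size_tuple leq_min => /andP[ji jn] <-.
  by exists (Ordinal jn); rewrite ?nth_take.
by rewrite -(nth_take 0 li) mem_nth // size_take_min size_tuple leq_min li ltn_ord.
Qed.

End Flags.

Lemma mem_flagG (K : fieldType) (V : vectType K) (n : nat) (e : n.-tuple V) i x :
  basis_of fullv e ->
  (x \in flagG e i) = [forall l : 'I_n, (coord e l x != 0) ==> (rev_ord l < i)%N].
Proof.
move=> he; have he' := rev_basis he; rewrite flagG_rev mem_flagF //.
have E (l : 'I_n) : coord [tuple of rev e] (rev_ord l) x = coord e l x.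
  have coord_e (j : 'I_n) : coord [tuple of rev e] (rev_ord l) e`_j = (l == j)%:R.
    have <- : [tuple of rev e]`_(rev_ord j) = e`_j.
      by rewrite -[LHS]/((rev e)`_(rev_ord j)) tnth_rev rev_ordK.
    by rewrite coord_nth // (inj_eq rev_ord_inj).
  rewrite {1}(coord_basis he (memvf x)) linear_sum (bigD1 l) //= linearZ /=.
  rewrite coord_e eqxx mulr1 big1 ?addr0 // => j jl.
  by rewrite linearZ /= coord_e eq_sym (negPf jl) mulr0.
apply/forallP/forallP => h l.
  by have := h (rev_ord l); rewrite E.
by have := h (rev_ord l); rewrite -E rev_ordK.
Qed.

Local Close Scope classical_set_scope.

Lemma sum_ltn N a : (\sum_(m < N) (m < a) = minn a N)%N.
Proof.
elim: N => [|N IH]; first by rewrite big_ord0 minn0.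
by rewrite big_ord_recr /= IH; case: ltnP; lia.
Qed.

Lemma sum_bool_card (I : finType) (b : pred I) :
  (\sum_i b i = #|[set i | b i]|)%N.
Proof.
by rewrite -sum1_card [RHS]big_mkcond; apply: eq_bigr => i _; rewrite inE; case: (b i).
Qed.

Lemma card_ltn_ord N a : #|[set r : 'I_N | (r < a)%N]| = minn a N.
Proof. by rewrite -sum_bool_card sum_ltn. Qed.

Lemma card_leq_ord N a : #|[set r : 'I_N | (a <= r)%N]| = (N - a)%N.
Proof.
have := cardsC [set r : 'I_N | (r < a)%N]; rewrite card_ltn_ord card_ord.
have -> : ~: [set r : 'I_N | (r < a)%N] = [set r : 'I_N | (a <= r)%N].
  by apply/setP => r; rewrite !inE -leqNgt.
by lia.
Qed.

Section AdaptedBases.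
Variables (K : fieldType) (k n : nat).
Implicit Types (B : 'M[K]_(k, n)) (om : 'I_n -> nat).

(** For the weight om l = l this is the last position in the support of row s, and for
    the opposite weight it tells the first one. *)
Definition height om B s := (\max_(l | (B s l != 0)%R) om l)%N.

Lemma row_free_neq0 B s : row_free B -> exists l, B s l != 0.
Proof.
move=> fB; have : row s B != 0.
  by rewrite rowE mulmx_free_eq0 //; apply/eqP/rowP => /(_ s)/eqP; rewrite !mxE !eqxx oner_eq0.
by case/rV0Pn => l; rewrite mxE; exists l.
Qed.

Lemma height_attained om B s : row_free B ->
  exists2 l, B s l != 0 & height om B s = om l.
Proof.
move=> fB; have [l0 nz] := row_free_neq0 s fB.
have [|l Bl hl] := @eq_bigmax_cond _ (fun l => B s l != 0) om.
  by apply/card_gt0P; exists l0.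
by exists l.
Qed.

Lemma le_height om B s l : B s l != 0 -> (om l <= height om B s)%N.
Proof. by move=> nz; apply: (leq_bigmax_cond (P := fun l => B s l != 0)). Qed.

(** Among all bases of a space take one for which the supports are shortest. If two
    rows had the same largest weight, subtracting a multiple of the row reaching
    less far in the other direction would shorten the other one. *)
Lemma minimal_height_inj om om' B : injective om -> row_free B ->
  (forall B', row_free B' -> (B' :=: B)%MS ->
     (\sum_s (height om B s + height om' B s) <=
      \sum_s (height om B' s + height om' B' s))%N) ->
  injective (height om B).
Proof.
move=> injom fB minB s t hst; apply: contrapT => /eqP nst.
wlog le_ts : s t hst nst / (height om' B t <= height om' B s)%N.
  move=> wl; have [/wl|/ltnW/wl] := leqP (height om' B t) (height om' B s); first exact.
  by apply; rewrite // eq_sym.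
have [l Bsl hl] := height_attained om s fB.
have Btl : B t l != 0.
  by have [l' Bt hl'] := height_attained om t fB; rewrite (injom l l') // -hl hst.
(* the multiple of row t that cancels the entry of largest weight in row s *)
pose c := B s l / B t l; pose C : 'M[K]_k := 1%:M - c *: delta_mx s t.
have CB a m : (C *m B) a m = B a m - (if a == s then c * B t m else 0).
  rewrite mulmxBl mul1mx -scalemxAl !mxE; congr (_ - _).
  rewrite (bigD1 t) //= big1 ?addr0 => [|j jt]; rewrite mxE.
    by rewrite eqxx andbT; case: eqP; rewrite ?mul1r // mul0r mulr0.
  by rewrite (negPf jt) andbF mul0r.
have uC : C \in unitmx.
  suff : C *m (1%:M + c *: delta_mx s t) = 1%:M by case/mulmx1_unit.
  rewrite mulmxDr mulmx1 mulmxBl mul1mx -scalemxAl -scalemxAr mul_delta_mx_cond.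
  by rewrite eq_sym (negPf nst) mulr0n !scaler0 subr0 subrK.
have eqC : (C *m B :=: B)%MS by apply: eqmxMfull; rewrite row_full_unit.
have fC : row_free (C *m B) by rewrite /row_free eqC.
have := minB _ fC eqC; rewrite leqNgt => /negP; apply.
rewrite (bigD1 s) //= [X in (_ < X)%N](bigD1 s) //=.
have Esum : (\sum_(i | i != s) (height om (C *m B) i + height om' (C *m B) i) =
    \sum_(i | i != s) (height om B i + height om' B i))%N.
  apply: eq_bigr => i /negPf nis; congr (_ + _)%N; apply: eq_bigl => m;
    by rewrite CB nis subr0.
rewrite Esum ltn_add2r -addSn; apply: leq_add.
  have [m nzm ->] := height_attained om s fC.
  have ml : m != l.
    by apply: contraNneq nzm => ->; rewrite CB eqxx divfK ?subrr.
  suff le : (om m <= height om B s)%N.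
    rewrite ltn_neqAle le andbT hl; apply: contra_neq ml; exact: injom.
  have [Bsm|] := eqVneq (B s m) 0; last exact: le_height.
  rewrite hst; apply: le_height; apply: contraNneq nzm => Btm.
  by rewrite CB eqxx Bsm Btm mulr0 subrr.
have [m nzm ->] := height_attained om' s fC.
have [Bsm|] := eqVneq (B s m) 0; last exact: le_height.
apply: leq_trans le_ts; apply: le_height; apply: contraNneq nzm => Btm.
by rewrite CB eqxx Bsm Btm mulr0 subrr.
Qed.

(** The existence part of the Bruhat decomposition, for the two flags that the weights
    define. *)
Lemma two_weight_basis om om' (A : 'M[K]_(k, n)) :
  injective om -> injective om' -> row_free A ->
  exists B, [/\ row_free B, (B :=: A)%MS, injective (height om B) &
    injective (height om' B)].
Proof.
move=> injom injom' fA; pose mu B := (\sum_s (height om B s + height om' B s))%N.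
pose Q N := `[< exists B, [/\ row_free B, (B :=: A)%MS & mu B = N] >].
have exQ : exists N, Q N by exists (mu A); apply/asboolP; exists A; split.
case: (ex_minnP exQ) => N /asboolP[B [fB BA muB]] minN.
have minB B' : row_free B' -> (B' :=: B)%MS -> (mu B <= mu B')%N.
  move=> fB' BB'; rewrite muB; apply: minN; apply/asboolP; exists B'; split=> //.
  exact: eqmx_trans BB' BA.
exists B; split=> //; first exact: minimal_height_inj (minB).
apply: (@minimal_height_inj om' om) => // B' fB' BB'.
have := minB _ fB' BB'; rewrite /mu => h.
under eq_bigr => s _ do rewrite addnC.
by under [in leqRHS]eq_bigr => s _ do rewrite addnC.
Qed.

(** With distinct heights no cancellation can lower the height of a combination. *)
Lemma height_mulmx om B (u : 'rV[K]_k) m : injective om -> row_free B ->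
  injective (height om B) ->
  (forall l, (u *m B) 0 l != 0 -> (om l < m)%N) ->
  forall s, u 0 s != 0 -> (height om B s < m)%N.
Proof.
move=> injom fB injh um s nzs.
have [t nzt maxt] := @arg_maxnP _ s (fun s => u 0 s != 0) (height om B) nzs.
apply: (@leq_ltn_trans (height om B t)); first exact: maxt.
have [l Btl hl] := height_attained om t fB; rewrite hl; apply: um.
rewrite mxE (bigD1 t) //= big1 ?addr0 ?mulf_neq0 // => j jt.
have [->|nzj] := eqVneq (u 0 j) 0; first by rewrite mul0r.
have [->|Bjl] := eqVneq (B j l) 0; first by rewrite mulr0.
have := le_height om Bjl; rewrite -hl => le_tj.
have /injh tj : height om B t = height om B j.
  by apply/eqP; rewrite eqn_leq le_tj; apply: maxt.
by rewrite tj eqxx in jt.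
Qed.

(** Compare, level by level, how many of the h s and of the u s lie above the level. *)
Lemma sum_heights (h u : 'I_k -> nat) :
  (forall s : 'I_k, (s < #|[set t | (h t < u s)%N]|)%N) ->
  (\sum_s (h s).+1 <= \sum_s u s)%N.
Proof.
move=> hu; pose N := (\max_s (h s).+1 + \max_s u s)%N.
have layer (g : 'I_k -> nat) : (forall s, (g s <= N)%N) ->
    (\sum_s g s = \sum_(m < N) (k - #|[set s | (g s <= m)%N]|))%N.
  move=> gN; transitivity (\sum_s \sum_(m < N) (m < g s))%N.
    by apply: eq_bigr => s _; rewrite sum_ltn (minn_idPl (gN s)).
  rewrite exchange_big; apply: eq_bigr => m _.
  rewrite sum_bool_card -[X in (X - _)%N](card_ord k) -(cardsC [set s | (g s <= m)%N]).
  rewrite addKn; apply: eq_card => s.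
  by rewrite !inE ltnNge.
rewrite !layer; first last.
- move=> s; apply: leq_trans (leq_addr _ _); exact: (leq_bigmax (F := fun s => (h s).+1)).
- move=> s; apply: leq_trans (leq_addl _ _); exact: leq_bigmax.
apply: leq_sum => m _; apply: leq_sub2l.
have [->|[s0 s0P]] := set_0Vmem [set s | (u s <= m)%N]; first by rewrite cards0.
have [s sP maxs] := @arg_maxnP _ s0 (fun s => s \in [set s | (u s <= m)%N]) val s0P.
apply: (@leq_trans s.+1).
  apply: (@leq_trans #|[set t : 'I_k | (t < s.+1)%N]|).
    by apply/subset_leq_card/fintype.subsetP => t /maxs; rewrite inE.
  by rewrite card_ltn_ord geq_minl.
apply: leq_trans (hu s) _; apply/subset_leq_card/fintype.subsetP => t; rewrite !inE => hts.
by apply: leq_trans hts _; move: sP; rewrite inE.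
Qed.

End AdaptedBases.

(** * The dimension of a Richardson variety and its tangent spaces *)

Section RichardsonDimension.
Variables (K : numFieldType) (V : vectType K).
Local Notation n := (\dim {:V}).
Variable e : n.-tuple V.
Hypothesis he : basis_of fullv e.
Variables (k : nat) (u v : 'I_k -> nat).

(** With w s = n - v (rev_ord s) this is the sum of the u s - w s - 1: row s has
    u s - w s entries, one of which can be normalized. *)
Definition richardson_dim := (\sum_s u s + \sum_s v s - k * n.+1)%N.

(** When the heights are distinct, a combination of rows lies in a member of the flag
    only if every row that it involves does. *)
Lemma dim_cap_heights (om : 'I_n -> nat) (B : 'M[K]_(k, n)) (U : {vspace V}) m :
  injective om -> row_free B -> injective (height om B) ->
  (forall x, x \in U -> forall l, rVof e x 0 l != 0 -> (om l < m)%N) ->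
  (\dim (row_span e B :&: U) <= #|[set t | (height om B t < m)%N]|)%N.
Proof.
move=> injom fB injh Um; set A := [set t | _].
have : (row_span e B :&: U <= <<[seq vecof e (row t B) | t <- enum A]>>)%VS.
  apply/subvP => x /memv_capP[]; rewrite mem_row_span // => /submxP[c xE] xU.
  rewrite -(rVofK he x) xE mulmx_sum_row linear_sum; apply: memv_suml => t _.
  rewrite linearZ /=; have [->|nzt] := eqVneq (c 0 t) 0; first by rewrite scale0r mem0v.
  apply/memvZ/memv_span/map_f; rewrite mem_enum inE.
  by apply: (height_mulmx injom fB injh _ nzt) => l; rewrite -xE; apply: Um.
move/dimvS/leq_trans; apply; apply: leq_trans (dim_span _) _.
by rewrite size_map -cardE.
Qed.

(** In a basis adapted to both flags the last positions of the rows add up to at most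
    the sum of the u s - 1, and the first positions to at least that of the
    n - v s. *)
Lemma richardson_basis (M : 'M[K]_(k, n)) :
  row_free M -> richardson e u v (row_span e M) ->
  exists (B : 'M[K]_(k, n)) (al be : {ffun 'I_k -> 'I_n}),
  [/\ row_free B, (B :=: M)%MS, forall s, B s (be s) != 0,
      forall s l, B s l != 0 -> (al s <= l <= be s)%N &
      (\sum_s (be s - al s) <= richardson_dim)%N].
Proof.
move=> fM [[_ MF] [_ MG]].
pose rv (l : 'I_n) : nat := rev_ord l.
have inj1 : injective (@nat_of_ord n) by apply: ord_inj.
have inj2 : injective rv.
  by move=> i j /ord_inj/rev_ord_inj.
have [B [fB BM injh injh']] := two_weight_basis inj1 inj2 fM.
have spanE : row_span e M = row_span e B.
  by apply/eqP; rewrite eqEsubv !row_span_sub // !BM !submx_refl.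
have hF : (\sum_s (height (@nat_of_ord n) B s).+1 <= \sum_s u s)%N.
  apply: sum_heights => s; apply: leq_trans (MF s) _; rewrite spanE.
  apply: dim_cap_heights => // x; rewrite mem_flagF // => /forallP xF l.
  by rewrite -coord_rVof; apply/implyP.
have hG : (\sum_s (height rv B s).+1 <= \sum_s v s)%N.
  apply: sum_heights => s; apply: leq_trans (MG s) _; rewrite spanE.
  apply: dim_cap_heights => // x; rewrite mem_flagG // => /forallP xG l.
  by rewrite -coord_rVof; apply/implyP.
have [be nzbe beE] := fin_all_exists2 (fun s => height_attained (@nat_of_ord n) s fB).
have [al nzal alE] := fin_all_exists2
  (fun s => height_attained rv s fB).
have supp s l : B s l != 0 -> (al s <= l <= be s)%N.
  move=> nz; rewrite -beE le_height // andbT.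
  have := le_height rv nz; rewrite alE /rv /=.
  by have := ltn_ord l; have := ltn_ord (al s); lia.
exists B, [ffun s => al s], [ffun s => be s]; split=> // [s|s l /supp|]; rewrite ?ffunE //.
rewrite /richardson_dim.
have E : (\sum_s ((be s - al s) + n.+1) =
    \sum_s ((height (@nat_of_ord n) B s).+1 +
            (height rv B s).+1))%N.
  apply: eq_bigr => s _; rewrite beE alE /rv /=.
  by have /andP[ab _] := supp _ _ (nzbe s); have := ltn_ord (al s); lia.
move: E; rewrite !big_split /= sum_nat_const card_ord => E.
under eq_bigr => s _ do rewrite !ffunE.
rewrite -[leqLHS](addnK (k * n.+1)%N); apply: leq_sub2r.
by apply: leq_trans (leq_add hF hG); rewrite -E.
Qed.

Definition interval_params (j : {ffun 'I_k -> 'I_n} * {ffun 'I_k -> 'I_n}) :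
    {set 'I_k * 'I_n} := [set p : 'I_k * 'I_n | (j.1 p.1 <= p.2 < j.2 p.1)%N].

(** j gives the first and the last position of every row. The last entry is normalized
    to 1, so only the positions before it carry parameters. *)
Definition interval_matrix j (y : 'rV[K]_(#|interval_params j|)) : 'M[K]_(k, n) :=
  \matrix_(s, l) (l == j.2 s)%:R +
  \sum_i y 0 i *: delta_mx (enum_val i).1 (enum_val i).2.

Lemma polymx_interval_matrix j : polymx (@interval_matrix j).
Proof.
apply: polymxD; first exact: polymx_cst.
move=> a c; have h : polyfun (fun y : 'rV[K]_(#|interval_params j|) =>
    \sum_i y 0 i * delta_mx (enum_val i).1 (enum_val i).2 a c).
  by apply: polyfun_sum => i; apply: polyfunM; [apply: polyfun_coord | apply: polyfun_cst].
by apply: polyfun_ext h => y; rewrite summxE; apply: eq_bigr => i _; rewrite [RHS]mxE.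
Qed.

Lemma card_interval_params j : #|interval_params j| = (\sum_s (j.2 s - j.1 s))%N.
Proof.
rewrite -sum_bool_card.
rewrite -(pair_bigA _ (fun s (l : 'I_n) => (j.1 s <= l < j.2 s)%N : nat)) /=.
apply: eq_bigr => s _; have := sum_ltn n (j.2 s); have := sum_ltn n (j.1 s).
rewrite !(minn_idPl (ltnW (ltn_ord _))).
have [lt|le] := leqP (j.1 s) (j.2 s) => E1 E2.
  rewrite -[in RHS]E1 -[in RHS]E2 -sumnB; last first.
    by move=> l _; case: ltnP => // /leq_trans/(_ lt)->.
  by apply: eq_bigr => l _; case: leqP => h1; case: leqP => //= h2; lia.
by rewrite big1 => [|l _]; [lia | case: leqP => h1; case: leqP => //= h2; lia].
Qed.

Lemma interval_matrixE (j : {ffun 'I_k -> 'I_n} * {ffun 'I_k -> 'I_n})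
    (B : 'M[K]_(k, n)) : (forall s, B s (j.2 s) = 1) ->
  (forall s l, B s l != 0 -> (j.1 s <= l <= j.2 s)%N) ->
  exists y, @interval_matrix j y = B.
Proof.
move=> B1 suppB; exists (\row_i B (enum_val i).1 (enum_val i).2).
apply/matrixP => s l; rewrite mxE mxE summxE.
under eq_bigr => i _ do rewrite mxE mxE mxE.
rewrite -(big_enum_val
  (fun p : 'I_k * 'I_n => B p.1 p.2 * ((s == p.1) && (l == p.2))%:R)) /=.
have [pS|npS] := boolP ((s, l) \in interval_params j).
  rewrite (bigD1 (s, l)) //= !eqxx mulr1 big1 ?addr0 => [|[s' l'] /andP[_ ne]].
    move: pS; rewrite inE /= => /andP[_ lt]; rewrite (_ : l == _ = false) ?add0r //.
    by apply/eqP => E; rewrite E ltnn in lt.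
  move: ne; rewrite /= xpair_eqE [s' == _]eq_sym [l' == _]eq_sym.
  by move/negPf->; rewrite mulr0.
rewrite big1 ?addr0 => [|[s' l'] p'S /=].
  have [->|ne] := eqVneq l (j.2 s); first by rewrite B1.
  apply/esym/eqP; apply: contraR npS => /suppB; rewrite inE /= => /andP[-> le].
  by rewrite ltn_neqAle le andbT.
case: eqP => [ss|]; last by rewrite mulr0.
case: eqP => [ll|]; last by rewrite mulr0.
by move: p'S npS; rewrite ss ll => ->.
Qed.

(** A basis as in richardson_basis, scaled so that its rows end in 1, has at most
    richardson_dim free entries, and there are finitely many shapes for it. *)
Lemma richardson_chain_bound (f : 'I_k -> 'I_n) x m c :
  irreducible_chain_at (chart_part e f (richardson e u v)) x m c ->
  (m <= richardson_dim)%N.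
Proof.
pose J := {j : {ffun 'I_k -> 'I_n} * {ffun 'I_k -> 'I_n} |
  (#|interval_params j| <= richardson_dim)%N}.
apply: (@chain_at_bound _ _ _ _ (fun=> 1) J (fun j => #|interval_params (val j)|)
  (fun j => chart_num f (@interval_matrix (val j)))
  (fun j => chart_den f (@interval_matrix (val j)))).
- exact: polyfun_cst.
- exact: oner_neq0.
- by move=> j; apply/polymx_chart_num/polymx_interval_matrix.
- by move=> j; apply/polyfun_chart_den/polymx_interval_matrix.
- by case.
move=> _ [M [M1 RM] <-] _.
have fM := colsub1_row_free M1.
have [B [al [be [fB BM nzbe suppB le]]]] := richardson_basis fM RM.
pose B1 := \matrix_(s, l) ((B s (be s))^-1 * B s l) : 'M[K]_(k, n).
have [|s l|y yE] := @interval_matrixE (al, be) B1.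
- by move=> s; rewrite mxE mulVf.
- by rewrite mxE mulf_eq0 negb_or => /andP[_ /suppB].
have leJ : (#|interval_params (al, be)| <= richardson_dim)%N.
  by rewrite card_interval_params.
suff [C uC B1E] : exists2 C : 'M_k, C \in unitmx & B1 = C *m M.
  have [uB nB] := normalize_mul uC M1.
  exists (exist _ (al, be) leJ); apply/rational_image_chart.
  by exists y; rewrite /= yE B1E ?nB.
have [C0 BE] : exists C0, B = C0 *m M by apply/submxP; rewrite BM.
have uC0 : C0 \in unitmx.
  by rewrite -row_free_unit /row_free -(mxrankMfree C0 fM) -BE.
exists (diag_mx (\row_s (B s (be s))^-1) *m C0).
  rewrite unitmx_mul uC0 andbT unitmxE unitfE det_diag.
  by apply/prodf_neq0 => s _; rewrite mxE invr_eq0.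
by rewrite -mulmxA -BE; apply/matrixP => s l; rewrite mul_diag_mx !mxE.
Qed.

End RichardsonDimension.

Section TangentLines.
Variables (K : numFieldType) (V : vectType K).
Local Notation n := (\dim {:V}).

Definition coordinate_mx k (f : 'I_k -> 'I_n) : 'M[K]_(k, n) :=
  \matrix_(s, l) (l == f s)%:R.

Definition coordinate_line k (f : 'I_k -> 'I_n) (p : 'I_k * 'I_n) (t : K) :=
  coordinate_mx f + t *: delta_mx p.1 p.2.

Lemma colsub_coordinate_line k (f : 'I_k -> 'I_n) p t : injective f ->
  (forall s, f s != p.2) -> colsub f (coordinate_line f p t) = 1%:M.
Proof.
move=> injf fp; apply/matrixP => i j; rewrite !mxE (negPf (fp j)) andbF mulr0 addr0.
by rewrite (inj_eq injf) eq_sym.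
Qed.

(** Lines through a torus fixed point whose directions are distinct matrix units give
    independent tangent vectors, which may outnumber the dimension. *)
Lemma not_smooth_of_lines (e : n.-tuple V) k (u v : 'I_k -> nat) f
    (P : {set 'I_k * 'I_n}) :
  basis_of fullv e -> injective f -> (forall p, p \in P -> forall s, f s != p.2) ->
  (forall p, p \in P -> forall t, richardson e u v (row_span e (coordinate_line f p t))) ->
  (richardson_dim V u v < #|P|)%N -> ~ smooth_subvariety e k (richardson e u v).
Proof.
move=> he injf fP lines big smooth; pose x := mxvec (coordinate_mx f).
have inZ p t : p \in P ->
    chart_part e f (richardson e u v) (x + t *: mxvec (delta_mx p.1 p.2)).
  move=> pP; exists (coordinate_line f p t); last by rewrite linearD linearZ.
  by split; [apply: colsub_coordinate_line => //; apply: fP | apply: lines].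
have [p0 p0P] : exists p0, p0 \in P by apply/card_gt0P; apply: leq_trans big.
have Zx : chart_part e f (richardson e u v) x.
  by have := inZ p0 0 p0P; rewrite scale0r addr0.
have [d [[[c chain] _] Td]] := smooth f injf x Zx.
suff le_d : (#|P| <= d)%N.
  by have := leq_trans (leq_trans big le_d) (richardson_chain_bound he chain); rewrite ltnn.
apply: (tangent_dim_ge Td (w := fun p => mxvec (delta_mx p.1 p.2))) => [p pP|l l0 p pP].
  apply: (@tangent_space_of_line _ _ _ _ _ 1); first exact: oner_neq0.
  by move=> t _; apply: inZ.
have := congr1 (fun z => (vec_mx z : 'M_(k, n)) p.1 p.2) l0.
rewrite /= linear0 linear_sum summxE [RHS]mxE (bigD1 p) //= linearZ /= mxvecK 2!mxE.
rewrite !eqxx mulr1.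
rewrite big1 ?addr0 // => q /andP[_ qp]; rewrite linearZ /= mxvecK !mxE.
case: eqP => [E1|]; case: eqP => [E2|]; rewrite ?mulr0 //.
by case/eqP: qp; rewrite [q]surjective_pairing -E1 -E2 -surjective_pairing.
Qed.

Section Lines.
Variables (e : n.-tuple V) (k : nat).
Hypothesis he : basis_of fullv e.

Lemma card_rows_le_dimv (M : 'M[K]_(k, n)) (U : {vspace V}) (A : {set 'I_k}) :
  row_free M -> (forall s, s \in A -> vecof e (row s M) \in U) -> (#|A| <= \dim U)%N.
Proof.
move=> fM MU; apply: (card_le_dimv MU) => l l0 s sA.
pose c : 'rV[K]_k := \row_s (if s \in A then l s else 0).
suff : c *m M == 0 by rewrite mulmx_free_eq0 // => /eqP/rowP/(_ s); rewrite !mxE sA.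
apply/eqP/(can_inj (vecofK he)); rewrite linear0 mulmx_sum_row linear_sum -[RHS]l0.
rewrite [RHS]big_mkcond; apply: eq_bigr => j _; rewrite linearZ mxE /=.
by case: ifP => // _; rewrite scale0r.
Qed.

Variables (u v w : 'I_k -> nat).
(* w s is the first position, counted from 0, that the opposite flag allows to row s;
   the flag F allows the positions below u s *)
Hypothesis wE : forall s, w s = (n - v (rev_ord s))%N.
Hypothesis hw : forall i j : 'I_k, (i < j)%N -> (w i < w j)%N.
Hypothesis hu : forall i j : 'I_k, (i < j)%N -> (u i < u j)%N.
Hypothesis wu : forall s, (w s < u s)%N.

(** Replacing w a by l in the set of values of w, and sorting again, moves the
    values w (a+1), ..., w c one place down; the result still lies below u. *)
Definition admissible (a : 'I_k) (l : 'I_n) :=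
  (forall s, w s != l) /\
  exists c : 'I_k, [/\ (a <= c)%N,
    forall s s' : 'I_k, (a <= s < c)%N -> s' = s.+1 :> nat -> (w s' < u s)%N &
    (w c < l < u c)%N].

Let w_le (i j : 'I_k) : (i <= j)%N -> (w i <= w j)%N.
Proof. by rewrite leq_eqVlt => /orP[/eqP/ord_inj->//|/hw/ltnW]. Qed.

Let u_le (i j : 'I_k) : (i <= j)%N -> (u i <= u j)%N.
Proof. by rewrite leq_eqVlt => /orP[/eqP/ord_inj->//|/hu/ltnW]. Qed.

(** On F the row w (s+1) stands in for the displaced row a when s lies between a and c;
    on the opposite flag nothing is lost, because l lies beyond w a. *)
Lemma coordinate_line_richardson (f : 'I_k -> 'I_n) a l t :
  (forall s, f s = w s :> nat) -> admissible a l ->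
  richardson e u v (row_span e (coordinate_line f (a, l) t)).
Proof.
move=> fE [wl [c [ac link /andP[cl lc]]]]; set M := coordinate_line _ _ _.
have injf : injective f.
  move=> i j E; apply: ord_inj; have := congr1 val E; rewrite /= !fE.
  by case: (ltngtP i j) => // /hw; lia.
have fM : row_free M.
  apply: (@colsub1_row_free _ _ _ f); apply: colsub_coordinate_line => // s.
  by rewrite -(inj_eq val_inj) /= fE.
have Mnz s j : M s j != 0 -> j = w s :> nat \/ s = a /\ j = l.
  rewrite !mxE /=; case: (j =P f s) => [->|_]; first by rewrite fE; left.
  case: (s =P a) => [->|_]; last by rewrite mulr0 addr0 eqxx.
  by case: (j =P l) => [->|_]; [right | rewrite mulr0 addr0 eqxx].
have dimM : grassmannian k (row_span e M) by rewrite /grassmannian /= dim_row_span //; apply/eqP.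
have rowM s : vecof e (row s M) \in row_span e M.
  by rewrite mem_row_span // vecofK // row_sub.
have coM s j : coord e j (vecof e (row s M)) = M s j by rewrite coord_vecof // mxE.
split; split=> // s.
  have inF r : (forall j, M r j != 0 -> (j < u s)%N) ->
      vecof e (row r M) \in (row_span e M :&: flagF e (u s))%VS.
    move=> h; rewrite memv_cap rowM mem_flagF //; apply/forallP => j.
    by apply/implyP; rewrite coM; apply: h.
  have [/andP[as_ sc]|nasc] := boolP (a <= s < c)%N.
    have lt : (s.+1 < k)%N by have := ltn_ord c; lia.
    pose s' := Ordinal lt; have w_s' : (w s' < u s)%N by apply: link; rewrite ?as_.
    apply: (@leq_trans #|[set r : 'I_k | (r < s.+2)%N] :\ a|).
      have := cardsD1 a [set r : 'I_k | (r < s.+2)%N].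
      by rewrite card_ltn_ord (minn_idPl lt); case: (a \in _); lia.
    apply: (card_rows_le_dimv fM) => r; rewrite !inE => /andP[ra rs].
    apply: inF => j /Mnz[->|[E _]]; last by rewrite E eqxx in ra.
    by apply: leq_ltn_trans w_s'; apply: w_le.
  rewrite -(minn_idPl (ltn_ord s)) -card_ltn_ord.
  apply: (card_rows_le_dimv fM) => r; rewrite inE ltnS => rs.
  apply: inF => j /Mnz[->|[E ->]]; first exact: leq_ltn_trans (w_le rs) (wu s).
  apply: leq_trans lc (u_le _); rewrite E in rs.
  by move: nasc; rewrite rs /= -leqNgt.
have -> : (s.+1 = #|[set r : 'I_k | (rev_ord s <= r)%N]|)%N.
  by rewrite card_leq_ord /= subKn.
apply: (card_rows_le_dimv fM) => r; rewrite inE => rs.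
rewrite memv_cap rowM mem_flagG //; apply/forallP => j; apply/implyP; rewrite coM.
have nw : (n - v s <= w r)%N by rewrite -{1}(rev_ordK s) -wE w_le.
have := ltn_ord j.
move=> jn /Mnz[E|[E1 E2]]; rewrite /=; first lia.
rewrite E1 in nw; have := w_le ac; rewrite -E2 in cl; lia.
Qed.

Hypothesis un : forall s, (u s <= n)%N.

(** The intervals of rows a and a+1 overlap, but the second does not end right after
    the first: the corner of the skew shape at which the variety is singular. *)
Definition right_jump (a : 'I_k) :=
  [exists a' : 'I_k, [&& nat_of_ord a' == a.+1, (w a' < u a)%N & ((u a).+1 < u a')%N]].

Lemma card_interval_ord (a b : nat) : (b <= n)%N ->
  #|[set l : 'I_n | (a < l < b)%N]| = (b - a.+1)%N.
Proof.
move=> bn; have := card_leq_ord n a.+1; have := card_leq_ord n b.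
have := cardsID [set l : 'I_n | (b <= l)%N] [set l : 'I_n | (a < l)%N].
have -> : [set l : 'I_n | (a < l)%N] :\: [set l : 'I_n | (b <= l)%N] =
    [set l : 'I_n | (a < l < b)%N].
  by apply/setP => l; rewrite !inE -ltnNge andbC.
have [ab|ba] := leqP b a.
  have -> : [set l : 'I_n | (a < l < b)%N] = finset.set0.
    by apply/setP => l; rewrite !inE; apply/negP; lia.
  by rewrite cards0; lia.
have -> : [set l : 'I_n | (a < l)%N] :&: [set l : 'I_n | (b <= l)%N] =
    [set l : 'I_n | (b <= l)%N].
  by apply/setP => l; rewrite !inE; case: (leqP b l); lia.
by lia.
Qed.

(** Descending induction on a. If a is linked to a+1 then every position admissible for
    a+1 is so for a, and the positions strictly between w a and w (a+1) are new. *)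
Lemma admissible_card a : exists S : {set 'I_n},
  (forall l, l \in S -> admissible a l) /\
  (u a - (w a).+1 + right_jump a <= #|S|)%N.
Proof.
have [m le_m] : exists m, (k <= a + m)%N by exists k; apply: leq_addl.
elim: m a le_m => [|m IH] a le_m; first by have := ltn_ord a; lia.
have [linked|nlinked] :=
    boolP [exists a' : 'I_k, (nat_of_ord a' == a.+1) && (w a' < u a)%N].
  have /existsP[a' /andP[/eqP a'E lt]] := linked.
  have [|S' [admS cardS]] := IH a'; first by lia.
  have wa' : (w a < w a')%N by apply: hw; rewrite a'E.
  have Sgt l : l \in S' -> (w a' < l)%N.
    case/admS => _ [c [ac _ /andP[cl _]]]; exact: leq_ltn_trans (w_le ac) cl.
  exists (S' :|: [set l : 'I_n | (w a < l < w a')%N]); split=> [l|].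
    rewrite inE => /orP[/admS[wl [c [ac link cl]]]|].
      split=> //; exists c; split=> // [|s s' /andP[as_ sc] s'E]; first by lia.
      have [ea|ne] := eqVneq s a.
        by have -> : s' = a' by [apply: ord_inj; rewrite s'E a'E ea]; rewrite ea.
      apply: link s'E; rewrite sc andbT a'E ltn_neqAle as_ andbT.
      by rewrite eq_sym.
    rewrite inE => /andP[al la']; split=> [s|].
      have [sa|as_] := leqP s a; first by have := w_le sa; apply: contraTneq => ->; lia.
      have /w_le : (a' <= s)%N by rewrite a'E.
      by apply: contraTneq => ->; lia.
    exists a; split=> // [s s' /andP[as_ sa]|]; first by lia.
    by rewrite al (ltn_trans la').
  rewrite cardsU (_ : S' :&: _ = finset.set0) ?cards0 ?subn0; last first.
    apply/setP => l; rewrite !inE; apply/negP => /andP[/Sgt h1 /andP[_ h2]].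
    by have := ltn_trans h1 h2; rewrite ltnn.
  rewrite card_interval_ord; last exact: leq_trans (ltnW lt) (un a).
  have ua' : (u a < u a')%N by apply: hu; rewrite a'E.
  have wua' := wu a'.
  have jump : (right_jump a <= (u a' - (u a).+1))%N.
    rewrite /right_jump; case: existsP => // -[a2 /and3P[/eqP a2E _ ju]].
    by have -> : a' = a2 by [apply: ord_inj; rewrite a'E a2E]; lia.
  by move: cardS; move: (right_jump a) (right_jump a') jump => [] []; lia.
have nj : right_jump a = false.
  apply/negbTE/negP => /existsP[a' /and3P[E lt _]]; case/negP: nlinked.
  by apply/existsP; exists a'; rewrite E.
exists [set l : 'I_n | (w a < l < u a)%N]; split=> [l|]; last first.
  by rewrite card_interval_ord // nj addn0.
rewrite inE => /andP[al lu]; split=> [s|].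
  have [sa|as_] := leqP s a; first by have := w_le sa; apply: contraTneq => ->; lia.
  have lt : (a.+1 < k)%N by apply: leq_ltn_trans as_ _.
  have /w_le : (Ordinal lt <= s)%N by [].
  have : ~~ (w (Ordinal lt) < u a)%N.
    apply: contra nlinked => h; apply/existsP; exists (Ordinal lt).
    by rewrite h eqxx.
  by rewrite -leqNgt => h1 h2; apply: contraTneq lu => <-; rewrite -leqNgt; lia.
by exists a; split=> // [s s' /andP[as_ sa]|]; [lia | rewrite al].
Qed.

(** At the coordinate subspace of w, row a moves along u a - w a - 1 lines at least,
    and along one more at a jump. *)
Lemma many_lines a0 : right_jump a0 -> (forall s, (v s <= n)%N) ->
  exists (f : 'I_k -> 'I_n) (P : {set 'I_k * 'I_n}),
  [/\ injective f, forall p, p \in P -> forall s, f s != p.2,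
    forall p, p \in P -> forall t, richardson e u v (row_span e (coordinate_line f p t)) &
    (richardson_dim V u v < #|P|)%N].
Proof.
move=> jump0 vn.
have wn s : (w s < n)%N by apply: leq_trans (wu s) (un s).
pose f s := Ordinal (wn s).
have [S admS] := fin_all_exists admissible_card.
exists f, [set p | p.2 \in S p.1]; split=> [i j /(congr1 val)/=|p|[a l]|].
- by case: (ltngtP i j) => [/hw|/hw|/ord_inj//] => + E; rewrite E ltnn.
- by rewrite inE => /(admS _).1[wl _] s; rewrite -(inj_eq val_inj) /= wl.
- by rewrite inE => /(admS _).1 adm t; apply: coordinate_line_richardson.
have -> : #|[set p : 'I_k * 'I_n | p.2 \in S p.1]| = (\sum_a #|S a|)%N.
  rewrite -sum_bool_card -(pair_bigA _ (fun a l => (l \in S a) : nat)) /=.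
  by apply: eq_bigr => a _; rewrite sum_bool_card; apply: eq_card => l; rewrite inE.
apply: (@leq_trans (\sum_a (u a - (w a).+1 + right_jump a))).
  2: by apply: leq_sum => a _; have [] := admS a.
rewrite big_split /= (bigD1 a0 (F := fun a => right_jump a : nat)) //= jump0.
have E : (\sum_a (u a - (w a).+1) + k * n.+1 = \sum_s u s + \sum_s v s)%N.
  have -> : (k * n.+1 = \sum_(s < k) n.+1)%N by rewrite sum_nat_const card_ord.
  rewrite (reindex_inj rev_ord_inj (F := v)) -!big_split /=; apply: eq_bigr => s _.
  by have := wu s; have := vn (rev_ord s); rewrite wE; lia.
by rewrite /richardson_dim -E addnK addnA -addn1 leq_addr.
Qed.

End Lines.
End TangentLines.

(** * Smooth Richardson varieties are Segre products *)

(** Inside L, of dimension k, the two intersections have dimensions at least b + 1 and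
    k - a. *)
Lemma richardson_cap_dim (K : fieldType) (V : vectType K) n (e : n.-tuple V) k
    (u v : 'I_k -> nat) (L : {vspace V}) (a b : 'I_k) : richardson e u v L ->
  (b.+1 - a <= \dim (L :&: (flagF e (u b) :&: flagG e (v (rev_ord a)))))%N.
Proof.
move=> [[dL LF] [_ LG]]; have := LF b; have := LG (rev_ord a).
have := dimv_sum_cap (L :&: flagF e (u b)) (L :&: flagG e (v (rev_ord a))).
have : (\dim (L :&: flagF e (u b) + L :&: flagG e (v (rev_ord a))) <= k)%N.
  by rewrite -[leqRHS]dL dimvS // subv_add !capvSl.
have -> : (L :&: flagF e (u b) :&: (L :&: flagG e (v (rev_ord a))) =
    L :&: (flagF e (u b) :&: flagG e (v (rev_ord a))))%VS.
  by apply/vspaceP => x; rewrite !memv_cap; case: (x \in L); rewrite ?andbF.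
by have := ltn_ord a; rewrite /=; lia.
Qed.

Section Blocks.
Variables (K : fieldType) (V : vectType K) (n : nat) (e : n.-tuple V).
Hypothesis he : basis_of fullv e.
Variables (k : nat) (u v w : 'I_k -> nat).
Hypothesis wE : forall s, w s = (n - v (rev_ord s))%N.
Hypothesis hu : forall i j : 'I_k, (i < j)%N -> (u i < u j)%N.
Hypothesis hv : forall i j : 'I_k, (i < j)%N -> (v i < v j)%N.
Hypothesis hw : forall i j : 'I_k, (i < j)%N -> (w i < w j)%N.

Let w_le (i j : 'I_k) : (i <= j)%N -> (w i <= w j)%N.
Proof. by rewrite leq_eqVlt => /orP[/eqP/ord_inj->//|/hw/ltnW]. Qed.

Let u_le (i j : 'I_k) : (i <= j)%N -> (u i <= u j)%N.
Proof. by rewrite leq_eqVlt => /orP[/eqP/ord_inj->//|/hu/ltnW]. Qed.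

Let v_le (i j : 'I_k) : (i <= j)%N -> (v i <= v j)%N.
Proof. by rewrite leq_eqVlt => /orP[/eqP/ord_inj->//|/hv/ltnW]. Qed.

(** Row s ranges over the positions l with w s <= l < u s, counted from 0; the runs of
    linked rows are the connected components of the skew shape. *)
Definition linked (s : nat) :=
  [exists a : 'I_k, exists a' : 'I_k,
     [&& nat_of_ord a == s, nat_of_ord a' == s.+1 & (w a' < u a)%N]].

Hypothesis parallel : forall a a' : 'I_k, a' = a.+1 :> nat -> (w a' < u a)%N ->
  u a' = (u a).+1 /\ v (rev_ord a) = (v (rev_ord a')).+1.

Lemma linkedP (a : 'I_k) : linked a -> exists a' : 'I_k,
  [/\ a' = a.+1 :> nat, u a' = (u a).+1 & v (rev_ord a) = (v (rev_ord a')).+1].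
Proof.
case/existsP => a1 /existsP[a' /and3P[/eqP/ord_inj-> /eqP a'E lt]]; exists a'.
by have [] := parallel a'E lt.
Qed.

Fixpoint block_start (s : nat) : nat :=
  if s is s'.+1 then (if linked s' then block_start s' else s) else 0.

Lemma block_start_le s : (block_start s <= s)%N.
Proof. by elim: s => //= s IH; case: ifP => _ //; apply: leqW. Qed.

Lemma linked_in_block b s : (block_start b <= s < b)%N -> linked s.
Proof.
elim: b => [|b IH] //=.
case: ifP => [lb|_]; last by move=> /andP[/leq_trans h /h]; rewrite ltnn.
move=> /andP[bs]; rewrite ltnS leq_eqVlt => /orP[/eqP->//|sb].
by apply: IH; rewrite bs.
Qed.

Definition start (b : 'I_k) : 'I_k :=
  Ordinal (leq_ltn_trans (block_start_le b) (ltn_ord b)).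

(** A block is a maximal run of linked rows, indexed by its last row; the other rows
    index blocks of size zero. *)
Definition block_size (b : nat) := if linked b then 0%N else (b.+1 - block_start b)%N.

Definition block_space (b : 'I_k) : {vspace V} :=
  if linked b then 0%VS else (flagF e (u b) :&: flagG e (v (rev_ord (start b))))%VS.

Lemma sum_block_size m : (\sum_(b < m) block_size b = block_start m)%N.
Proof.
elim: m => [|m IH]; first by rewrite big_ord0.
rewrite big_ord_recr /= IH /block_size; case: ifP => _; first by rewrite addn0.
by rewrite subnKC // leqW // block_start_le.
Qed.

Lemma sum_block_size_lt m : (m <= k)%N ->
  (\sum_(b < k | (b < m)%N) block_size b = block_start m)%N.
Proof. by move=> mk; rewrite -sum_block_size (big_ord_widen k). Qed.

Lemma block_start_k : block_start k = k.
Proof.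
suff h m : m = k -> block_start m = m by apply: h.
case: m => [|m] //= mk; case: ifP => // /existsP[a /existsP[a' /and3P[_ /eqP a'E _]]].
by have := ltn_ord a'; rewrite a'E mk ltnn.
Qed.

Lemma mem_block_space b x (j : 'I_n) : x \in block_space b -> coord e j x != 0 ->
  [/\ ~~ linked b, (w (start b) <= j)%N & (j < u b)%N].
Proof.
rewrite /block_space; case: ifP => [_|nl].
  by rewrite memv0 => /eqP->; rewrite linear0 eqxx.
rewrite memv_cap mem_flagF // mem_flagG // => /andP[/forallP xF /forallP xG] nz.
split=> //; last exact: implyP (xF j) nz.
by have := implyP (xG j) nz; rewrite wE /=; have := ltn_ord j; lia.
Qed.

Lemma block_spaces_disjoint (b b' : 'I_k) : (b < b')%N -> ~~ linked b ->
  (u b <= w (start b'))%N.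
Proof.
move=> lt nl; have lt_s : (b < block_start b')%N.
  by rewrite ltnNge; apply: contra nl => le; apply: (linked_in_block (b := b')); rewrite le.
have b1 : (b.+1 < k)%N by apply: leq_ltn_trans lt _.
have : (w (Ordinal b1) <= w (start b'))%N by apply: w_le.
apply: leq_trans; rewrite leqNgt; apply: contra nl => h.
by apply/existsP; exists b; apply/existsP; exists (Ordinal b1); rewrite !eqxx.
Qed.

Lemma directv_block_spaces : directv (\sum_(b < k) block_space b)%VS.
Proof.
apply/directv_sum_independent => x xV x0 b _.
rewrite (coord_basis he (memvf (x b))) big1 // => j _.
have [->|nz] := eqVneq (coord e j (x b)) 0; first by rewrite scale0r.
have := congr1 (coord e j) x0; rewrite linear0 linear_sum (bigD1 b) //= big1 ?addr0.
  by move=> E; rewrite E eqxx in nz.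
move=> b' bb'; apply/eqP/negPn/negP => nz'.
have [nl lo hi] := mem_block_space (xV b isT) nz.
have [nl' lo' hi'] := mem_block_space (xV b' isT) nz'.
case: (ltngtP b b') => [/block_spaces_disjoint/(_ nl)|/block_spaces_disjoint/(_ nl')|/ord_inj E].
- by lia.
- by lia.
- by rewrite E eqxx in bb'.
Qed.

Lemma dim_sum_sub_blocks (W : 'I_k -> {vspace V}) (Q : pred 'I_k) :
  (forall b, (W b <= block_space b)%VS) ->
  \dim (\sum_(b | Q b) W b)%VS = (\sum_(b | Q b) \dim (W b))%N.
Proof.
move=> WV; apply/directvP/directv_sum_independent => x xW x0 b Qb /=.
have /directv_sum_independent := directv_block_spaces.
move/(_ (fun b => if Q b then x b else 0)); rewrite -big_mkcond x0.
move/(_ _ erefl b isT); rewrite Qb; apply => c _.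
by case: ifP => [Qc|_]; [apply: (subvP (WV c)); apply: xW | rewrite mem0v].
Qed.

Let flagF_le i j : (i <= j)%N -> (flagF e i <= flagF e j)%VS.
Proof.
move=> ij; apply/subvP => x; rewrite !mem_flagF // => /forallP h.
by apply/forallP => l; apply/implyP => /(implyP (h l)) /leq_trans; apply.
Qed.

Let flagG_le i j : (i <= j)%N -> (flagG e i <= flagG e j)%VS.
Proof.
move=> ij; apply/subvP => x; rewrite !mem_flagG // => /forallP h.
by apply/forallP => l; apply/implyP => /(implyP (h l)) /leq_trans; apply.
Qed.

(** The conditions at the ends of the blocks hold because whole summands satisfy them;
    inside a block both sequences move by one, so each condition follows from the next
    one, as passing to the previous member of a flag costs at most one dimension. *)
Lemma segre_blocks_richardson (W : 'I_k -> {vspace V}) :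
  (forall b, (W b <= block_space b)%VS) -> (forall b, \dim (W b) = block_size b) ->
  richardson e u v (\sum_(b < k) W b)%VS.
Proof.
move=> WV dW; set L := (\sum_(b < k) W b)%VS.
have part (Q : pred 'I_k) (U : {vspace V}) :
    (forall b, Q b -> ~~ linked b -> (block_space b <= U)%VS) ->
    (\sum_(b | Q b) block_size b <= \dim (L :&: U))%N.
  move=> QU; rewrite (eq_bigr (fun b => \dim (W b))) => [|b _]; last by rewrite dW.
  rewrite -dim_sum_sub_blocks // dimvS // subv_cap; apply/andP; split.
    by apply/subv_sumP => b Qb; apply: (sumv_sup b).
  apply/subv_sumP => b Qb; have [lb|/(QU b Qb)] := boolP (linked b).
    by apply: subv_trans (WV b) _; rewrite /block_space lb sub0v.
  exact: subv_trans (WV b).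
have dimL : grassmannian k L.
  rewrite /grassmannian /= /L dim_sum_sub_blocks // -[RHS]block_start_k -sum_block_size.
  by apply: eq_bigr => b _.
split; split=> // s.
  have [m] : exists m, (k <= s + m)%N by exists k; apply: leq_addl.
  elim: m s => [|m IH] s le_m; first by have := ltn_ord s; lia.
  have [/linkedP[a' [a'E ua' _]]|nl] := boolP (linked s).
    have := leq_trans (IH a' _) (_ : _ <= (\dim (L :&: flagF e (u s))).+1)%N.
    by rewrite a'E ltnS; apply; [lia | rewrite ua' dim_cap_flagF_step].
  have <- : (\sum_(b < k | (b < s.+1)%N) block_size b = s.+1)%N.
    by rewrite sum_block_size_lt //= (negPf nl).
  apply: part => b bs nlb; rewrite /block_space (negPf nlb).
  by apply: subv_trans (capvSl _ _) _; apply/flagF_le/u_le.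
have at_start (r : 'I_k) : block_start r = r ->
    (k - r <= \dim (L :&: flagG e (v (rev_ord r))))%N.
  move=> str; have <- : (\sum_(b < k | ~~ (b < r)%N) block_size b = k - r)%N.
    have := sum_block_size k; rewrite block_start_k (bigID (fun b : 'I_k => (b < r)%N)) /=.
    by rewrite sum_block_size_lt ?(ltnW (ltn_ord r)) // str; lia.
  apply: part => b; rewrite -leqNgt => rb nlb; rewrite /block_space (negPf nlb).
  apply: subv_trans (capvSr _ _) _; apply/flagG_le/v_le; apply: leq_sub2l.
  rewrite ltnS /= leqNgt; apply/negP => lt.
  move: rb str lt; case: (nat_of_ord r) => // r' rb /=.
  rewrite ltnS => + le; rewrite (@linked_in_block b); last by rewrite le.
  by have := block_start_le r'; lia.
suff h m (r : 'I_k) : nat_of_ord r = m -> (k - r <= \dim (L :&: flagG e (v (rev_ord r))))%N.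
  by have := h _ (rev_ord s) erefl; rewrite rev_ordK /= subKn.
elim: m r => [|m IH] r rm; first by apply: at_start; rewrite rm.
have [lm|nlm] := boolP (linked m); last by apply: at_start; rewrite rm /= (negPf nlm).
have mk : (m < k)%N by have := ltn_ord r; lia.
have [a' [a'E _ va']] := linkedP (a := Ordinal mk) lm.
have ra' : r = a' by apply: ord_inj; rewrite a'E rm.
have := leq_trans (IH (Ordinal mk) erefl) (_ : _ <= (\dim (L :&: flagG e (v (rev_ord r)))).+1)%N.
by rewrite va' ra' dim_cap_flagG_step a'E /= => /(_ isT); lia.
Qed.

(** The intersections of L with the block spaces are at least as large as the sizes of
    the blocks, and these already add up to k. *)
Lemma richardson_is_segre_product : (exists L, richardson e u v L) ->
  \dim {:V} = n -> is_segre_product n k (richardson e u v).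
Proof.
move=> [L0 R0] dimV.
have cap_ge L (b : 'I_k) : richardson e u v L -> (block_size b <= \dim (L :&: block_space b))%N.
  move=> RL; rewrite /block_size /block_space; case: ifP => // _.
  exact: (richardson_cap_dim (start b)).
exists k, (fun b : 'I_k => block_size b), (fun b => \dim (block_space b)), block_space.
split; split=> //.
- by move=> b; apply: leq_trans (cap_ge L0 b R0) _; rewrite dimvS // capvSr.
- by rewrite sum_block_size block_start_k.
- by rewrite -(dim_sum_sub_blocks _ (fun b => subvv _)) -[leqRHS]dimV dimvS // subvf.
- exact: directv_block_spaces.
apply/boolp.funext => L; apply/boolp.propext; split=> [RL|[W WV <-]]; last first.
  by apply: segre_blocks_richardson => b; have [] := WV b.
pose W (b : 'I_k) := (L :&: block_space b)%VS.
have WV (b : 'I_k) : (W b <= block_space b)%VS by apply: capvSr.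
have WL : (\sum_b W b <= L)%VS by apply/subv_sumP => b _; apply: capvSl.
have dL : \dim L = k by have [[]] := RL.
have le_k : (\sum_b \dim (W b) <= k)%N by rewrite -dim_sum_sub_blocks // -[leqRHS]dL dimvS.
have sumE : (\sum_(b < k) block_size b = k)%N by rewrite sum_block_size block_start_k.
have [le_sum eq_sum] := leqif_sum (fun b (_ : true) => leqif_eq (cap_ge L b RL)).
have dW b : \dim (W b) = block_size b.
  have : (\sum_(b < k) block_size b == \sum_b \dim (W b))%N.
    by rewrite eqn_leq le_sum sumE.
  by rewrite eq_sum => /forallP/(_ b)/eqP->.
exists W; first by move=> b; split.
apply/eqP; rewrite eqEdim WL dim_sum_sub_blocks // dL.
by rewrite (eq_bigr _ (fun b _ => dW b)) sumE leqnn.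
Qed.

End Blocks.

Lemma richardson_rev (K : fieldType) (V : vectType K) n (e : n.-tuple V) k
    (u v : 'I_k -> nat) :
  richardson [tuple of rev e] v u = richardson e u v.
Proof.
rewrite /richardson classical_sets.setIC; congr (classical_sets.setI _ _).
apply/boolp.funext => L; rewrite /schubertG /schubertF /=.
apply/boolp.propext; split=> -[dL h]; split=> // s;
  by have := h s; rewrite /flagG /flagF /= revK.
Qed.

Lemma row_span_rev (K : fieldType) (V : vectType K) n (e : n.-tuple V) k
    (M : 'M[K]_(k, n)) :
  row_span [tuple of rev e] M = row_span e (colsub (@rev_ord n) M).
Proof.
congr <<_>>%VS; apply: eq_map => i.
rewrite (reindex_inj rev_ord_inj); apply: eq_bigr => j _.
by rewrite mxE -[[tuple of rev e]`_ _]/((rev e)`_(rev_ord j)) tnth_rev rev_ordK.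
Qed.

Section SmoothRichardson.
Variables (K : numFieldType) (V : vectType K).
Local Notation n := (\dim {:V}).
Variable e : n.-tuple V.
Hypothesis he : basis_of fullv e.
Variables (k : nat) (u v : 'I_k -> nat).
Hypotheses (hu : schubert_index n u) (hv : schubert_index n v).
Hypothesis hne : exists L, richardson e u v L.

Let w s := (n - v (rev_ord s))%N.

Let hw : forall i j : 'I_k, (i < j)%N -> (w i < w j)%N.
Proof.
move=> i j ij; have : (v (rev_ord j) < v (rev_ord i))%N.
  by apply: hv.2 => /=; have := ltn_ord j; lia.
by rewrite /w; have := hv.1 (rev_ord i); lia.
Qed.

Let wu s : (w s < u s)%N.
Proof.
have [L RL] := hne.
have := richardson_cap_dim s s RL; rewrite subSnn lt0n dimv_eq0 => nz.
have := memv_pick (L :&: (flagF e (u s) :&: flagG e (v (rev_ord s)))).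
rewrite !memv_cap mem_flagF // mem_flagG // => /and3P[_ /forallP xF /forallP xG].
move: nz; rewrite -vpick0 => nz.
have [j nzj] : exists j, coord e j (vpick (L :&: (flagF e (u s) :&: flagG e (v (rev_ord s))))) != 0.
  apply/existsP; apply: contraR nz => /existsPn all0.
  rewrite (coord_basis he (memvf (vpick _))) big1 // => j _.
  by have /negPn/eqP-> := all0 j; rewrite scale0r.
have := implyP (xF j) nzj; have := implyP (xG j) nzj.
by rewrite /w /=; have := ltn_ord j; lia.
Qed.

(** The singular point is the coordinate subspace of w for a jump of u; reversing the
    basis exchanges u with v, so that for a jump of v it is the one of u. *)
Lemma smooth_no_right_jump : smooth_subvariety e k (richardson e u v) ->
  forall a, ~~ right_jump u w a.
Proof.
move=> smooth a; apply/negP => jump.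
have un s : (u s <= n)%N by have /andP[] := hu.1 s.
have vn s : (v s <= n)%N by have /andP[] := hv.1 s.
have [f [P [injf fP lines big]]] := many_lines he (fun _ => erefl) hw hu.2 wu un jump vn.
exact: (not_smooth_of_lines he injf fP lines big).
Qed.

Let w' s := (n - u (rev_ord s))%N.

Let hw' : forall i j : 'I_k, (i < j)%N -> (w' i < w' j)%N.
Proof.
move=> i j ij; have : (u (rev_ord j) < u (rev_ord i))%N.
  by apply: hu.2 => /=; have := ltn_ord j; lia.
by rewrite /w'; have := hu.1 (rev_ord i); lia.
Qed.

Let w'v s : (w' s < v s)%N.
Proof.
have := wu (rev_ord s); rewrite /w /w' rev_ordK.
by have := hu.1 (rev_ord s); have := hv.1 s; lia.
Qed.

Lemma smooth_no_left_jump : smooth_subvariety e k (richardson e u v) ->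
  forall a, ~~ right_jump v w' a.
Proof.
move=> smooth a; apply/negP => jump.
have un s : (u s <= n)%N by have /andP[] := hu.1 s.
have vn s : (v s <= n)%N by have /andP[] := hv.1 s.
have [f [P [injf fP lines big]]] :=
  many_lines (rev_basis he) (fun _ => erefl) hw' hv.2 w'v vn jump un.
pose rv (p : 'I_k * 'I_n) := (p.1, rev_ord p.2).
have rvK : involutive rv by move=> [i j]; rewrite /rv /= rev_ordK.
apply: (@not_smooth_of_lines _ _ e _ _ _ (fun s => rev_ord (f s)) (rv @: P)) smooth => //.
- by move=> i j /rev_ord_inj/injf.
- by move=> _ /imsetP[p pP ->] s /=; rewrite (inj_eq rev_ord_inj); apply: fP.
- move=> _ /imsetP[p pP ->] t; have := lines p pP t.
  rewrite richardson_rev row_span_rev; congr (richardson e u v (row_span e _)).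
  apply/matrixP => i j; rewrite !mxE /= (can2_eq rev_ordK rev_ordK).
  by rewrite [rev_ord j == p.2](can2_eq rev_ordK rev_ordK).
rewrite card_imset; last exact: inv_inj.
by move: big; rewrite /richardson_dim [X in (X - _)%N]addnC.
Qed.

Lemma smooth_richardson_is_segre : smooth_subvariety e k (richardson e u v) ->
  is_segre_product n k (richardson e u v).
Proof.
move=> smooth.
apply: (@richardson_is_segre_product _ _ _ e he k u v w) => // [||a a' a'E lt].
- exact: hu.2.
- exact: hv.2.
have ua' : (u a < u a')%N by apply: hu.2; rewrite a'E.
have va' : (v (rev_ord a') < v (rev_ord a))%N.
  by apply: hv.2; rewrite /= a'E; have := ltn_ord a'; lia.
split; apply/eqP; rewrite eqn_leq ?ua' ?va' andbT leqNgt.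
  apply: contra (smooth_no_right_jump smooth a) => ju.
  by apply/existsP; exists a'; rewrite a'E eqxx lt.
apply: contra (smooth_no_left_jump smooth (rev_ord a')) => ju.
apply/existsP; exists (rev_ord a); rewrite ju andbT /w' rev_ordK /= a'E.
apply/andP; split; first by apply/eqP; have := ltn_ord a'; lia.
move: lt; rewrite /w; have := hu.1 a; have := hv.1 (rev_ord a'); lia.
Qed.

End SmoothRichardson.

Local Open Scope classical_set_scope.

Theorem corollary2p13 (R : realType) (n k : nat) (V : vectType R[i])
    (e : n.-tuple V) (he : basis_of fullv e) (u v : 'I_k -> nat)
    (hu : schubert_index n u) (hv : schubert_index n v)
    (hne : richardson e u v !=set0) :
  smooth_subvariety e k (richardson e u v) <->
  is_segre_product n k (richardson e u v).
Proof.
have nE : n = \dim {:V} by rewrite (vector.size_basis he).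
subst n; split; first exact: smooth_richardson_is_segre.
by move=> [r [ks [ns [Vs [_ [_ dV ->]]]]]]; apply: segre_product_smooth.
Qed.
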